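(* Let $(\bar{M}, g)$ be a compact Riemannian manifold with smooth boundary $\partial M$, with $n = \dim \bar{M} \geqslant 3$. Then there exists a metric $\tilde{g}$ conformal to $g$ whose mean curvature $\tilde{h}$ on $\partial M$ satisfies $\tilde{h} < 0$ everywhere on $\partial M$.
   Context: A metric conformal to $g$ is a metric of the form $\tilde{g} = u^{p-2} g$ with $p = \frac{2n}{n-2}$ and $u \in C^{\infty}(\bar{M})$, $u > 0$ on $\bar{M}$. The mean curvature is taken with respect to the outward unit normal $\nu$, with sign and normalization such that under $\tilde{g} = e^{2f} g$ it transforms as $\tilde{h} = e^{-f}\left(h_{g} + \frac{\partial f}{\partial \nu}\right)$ (the average of the principal curvatures, positive for the Euclidean ball). *)

(* Defs.v *)
From HB Require Import structures.
From mathcomp Require Import all_boot all_order all_algebra.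
From mathcomp Require Import all_classical all_reals all_analysis.

Set Implicit Arguments.
Unset Strict Implicit.
Unset Printing Implicit Defensive.

Import Order.TTheory GRing.Theory Num.Theory.
Import numFieldNormedType.Exports.

Local Open Scope classical_set_scope.
Local Open Scope ring_scope.

(* Points of R^(m+1) are row vectors.  Manifolds have dimension m+1, their
   boundary has dimension m; coordinate [ord0] is the one normal to the
   boundary, and coordinates [lift ord0 a], [a : 'I_m], are tangential. *)

Section EuclideanCalculus.
Context {R : realType} {m : nat}.
Implicit Types (x : 'rV[R]_m.+1) (i : 'I_m.+1).

Definition coord_vec i : 'rV[R]_m.+1 := delta_mx ord0 i.

Definition half_space : set 'rV[R]_m.+1 := [set x | 0 <= x ord0 ord0].

Fixpoint Ck (V : normedModType R) (k : nat) (U : set 'rV[R]_m.+1)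
    (f : 'rV[R]_m.+1 -> V) : Prop :=
  match k with
  | 0 => forall x, U x -> {for x, continuous f}
  | k'.+1 => (forall x, U x -> differentiable f x) /\
             forall i, Ck k' U (fun x => 'D_(coord_vec i) f x)
  end.

(* Smoothness on a set which need not be open: local smooth extendability. *)
Definition smooth_on (V : normedModType R) (D : set 'rV[R]_m.+1)
    (f : 'rV[R]_m.+1 -> V) : Prop :=
  forall x, D x -> exists (U : set 'rV[R]_m.+1) (F : 'rV[R]_m.+1 -> V),
    [/\ open U, U x, forall k, Ck k U F & forall y, (U `&` D) y -> F y = f y].

(* The increment is restricted to the half-space, so that at a point of
   [{x_0 = 0}] the derivative in the normal coordinate is one-sided; in every
   other case this is the usual partial derivative. *)
Definition partial (f : 'rV[R]_m.+1 -> R) i x : R :=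
  lim ((fun t : R => t^-1 * (f (x + t *: coord_vec i) - f x))
    @ within [set t | half_space (x + t *: coord_vec i)] (0 : R)^').

End EuclideanCalculus.

Section Manifold.
Variables (R : realType) (m : nat).

Record chart (T : topologicalType) := Chart {
  chart_dom : set T;
  chart_map : T -> 'rV[R]_m.+1;
  chart_inv : 'rV[R]_m.+1 -> T;
  chart_dom_open : open chart_dom;
  chart_image_open : exists2 U : set 'rV[R]_m.+1,
    open U & chart_map @` chart_dom = U `&` half_space;
  chart_mapK : {in chart_dom, cancel chart_map chart_inv};
  chart_map_continuous : {within chart_dom, continuous chart_map};
  chart_inv_continuous :
    {within chart_map @` chart_dom, continuous chart_inv}
}.

Definition chart_image (T : topologicalType) (c : chart T) :
    set 'rV[R]_m.+1 :=
  chart_map c @` chart_dom c.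

Definition transition (T : topologicalType) (c d : chart T)
    (x : 'rV[R]_m.+1) : 'rV[R]_m.+1 :=
  chart_map d (chart_inv c x).

(* Smooth manifolds with (possibly empty) boundary, of dimension m+1. *)
Record manifold := Manifold {
  carrier :> topologicalType;
  atlas : set (chart carrier);
  manifold_hausdorff : hausdorff_space carrier;
  manifold_second_countable : @second_countable carrier;
  atlas_cover : forall p : carrier, exists2 c, atlas c & chart_dom c p;
  atlas_compatible : forall c d, atlas c -> atlas d ->
    smooth_on (chart_map c @` (chart_dom c `&` chart_dom d)) (transition c d)
}.

Definition boundary (M : manifold) : set M :=
  [set p | exists c : chart M,
     [/\ atlas c, chart_dom c p & chart_map c p ord0 ord0 = 0]].

Definition smooth_fun (M : manifold) (u : M -> R) : Prop :=
  forall c : chart M, atlas c ->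
    smooth_on (chart_image c) (fun x => u (chart_inv c x) : R^o).

(* Entry (i, a) is the derivative of the a-th coordinate of d with respect to
   the i-th coordinate of c. *)
Definition transition_jacobian (M : manifold) (c d : chart M)
    (x : 'rV[R]_m.+1) : 'M[R]_m.+1 :=
  \matrix_(i, a) partial (fun y => transition c d y ord0 a) i x.

(* [components g c x] is the matrix of g(d_i, d_j) in the chart c at the point
   of coordinates x; its values outside the image of c, or for c outside the
   atlas, are irrelevant. *)
Record riemannian_metric (M : manifold) := RiemannianMetric {
  components : chart M -> 'rV[R]_m.+1 -> 'M[R]_m.+1;
  metric_sym : forall c x, atlas c -> chart_image c x ->
    (components c x)^T = components c x;
  metric_pos : forall c x (v : 'rV[R]_m.+1), atlas c -> chart_image c x ->
    v != 0 -> 0 < (v *m components c x *m v^T) ord0 ord0;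
  metric_smooth : forall c, atlas c -> smooth_on (chart_image c) (components c);
  metric_transform : forall c d p, atlas c -> atlas d ->
    chart_dom c p -> chart_dom d p ->
    let J := transition_jacobian c d (chart_map c p) in
    components c (chart_map c p) = J *m components d (chart_map d p) *m J^T
}.

Definition conformal_exponent : R := 2 * m.+1%:R / (m.+1%:R - 2).

Definition conformal (M : manifold) (g gt : riemannian_metric M) : Prop :=
  exists u : M -> R,
    [/\ smooth_fun u, forall p, 0 < u p &
        forall c p, atlas c -> chart_dom c p ->
          components gt c (chart_map c p) =
          (u p `^ (conformal_exponent - 2)) *: components g c (chart_map c p)].

End Manifold.

Section MeanCurvature.
Context {R : realType} {m : nat}.
Implicit Types (G : 'rV[R]_m.+1 -> 'M[R]_m.+1) (x : 'rV[R]_m.+1).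

(* Christoffel symbol of the second kind, with upper index k. *)
Definition christoffel G (k i j : 'I_m.+1) x : R :=
  2^-1 * \sum_l invmx (G x) k l *
    (partial (fun y => G y j l) i x + partial (fun y => G y i l) j x
     - partial (fun y => G y i j) l x).

(* The outward unit normal is - grad x_0 / |grad x_0|: the manifold lies in
   the region where x_0 is nonnegative. *)
Definition outward_normal G x : 'rV[R]_m.+1 :=
  - (Num.sqrt (invmx (G x) ord0 ord0))^-1 *: row ord0 (invmx (G x)).

Definition induced_metric G x : 'M[R]_m :=
  \matrix_(a, b) G x (lift ord0 a) (lift ord0 b).

(* II(X, Y) = g(nabla_X nu, Y) = - g(nabla_X Y, nu) on coordinate fields; the
   sign makes the boundary of a Euclidean ball positively curved. *)
Definition second_fundamental_form G x : 'M[R]_m :=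
  \matrix_(a, b) - \sum_k \sum_l
    christoffel G k (lift ord0 a) (lift ord0 b) x * G x k l
      * outward_normal G x ord0 l.

(* The principal curvatures are the eigenvalues of the shape operator, of
   matrix (induced metric)^-1 * II. *)
Definition coord_mean_curvature G x : R :=
  m%:R^-1 * \tr (invmx (induced_metric G x) *m second_fundamental_form G x).

(* The mean curvature at the boundary point p, computed in a chart c of the
   atlas around p; the value does not depend on c. *)
Definition mean_curvature (M : manifold R m) (g : riemannian_metric M)
    (c : chart R m M) (p : M) : R :=
  coord_mean_curvature (components g c) (chart_map c p).

End MeanCurvature.

(* Main.v *)
(* Multiply g by expR f, where f >= 0 vanishes on the boundary and has a large
   inward normal derivative.  In a boundary chart with coordinates x_0 >= 0 the
   mean curvature is a positive multiple of
     tr (h^-1 * Gamma^0),   h the induced metric,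
   and passing to expR f * g subtracts m/2 * g^00 * d_0 f from this trace, since
   f = 0 and d_a f = 0 (a tangential) on the boundary.
   Near each point take f = x_0 * b, with b a bump function of the chart scaled
   so that m/2 * g^00 * b exceeds the trace; by compactness finitely many such
   functions suffice, and their sum still works because every summand is
   nonnegative and vanishes on the boundary.
   The sign has to be checked in every chart, not only in the chosen ones: under
   a change of charts with Jacobian J the trace is multiplied by J_00 > 0, the
   second derivatives of the transition map cancelling by Schwarz's theorem. *)

Require Import Defs.
From HB Require Import structures.
From mathcomp Require Import all_boot all_order all_algebra.
From mathcomp Require Import all_classical all_reals all_analysis.
From mathcomp Require Import ring.

Set Implicit Arguments.
Unset Strict Implicit.
Unset Printing Implicit Defensive.

Import Order.TTheory GRing.Theory Num.Theory.
Import numFieldNormedType.Exports.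

Local Open Scope classical_set_scope.
Local Open Scope ring_scope.

(** * Calculus of [Ck] functions *)

Section Differentiation.
Context {R : realType}.
Implicit Types V W : normedModType R.

(** Chart expressions are meaningful only on relatively open pieces of the half-space, and the
    derivatives entering the mean curvature are one-sided there. Every analytic step therefore
    passes to a smooth extension on an open set: [partialE] identifies [partial] with the full
    derivative of any such extension, and facts known only on the half-space are exploited along
    rays [t > 0] that stay in it. The geometry is isolated in [jet_curv], an algebraic function of a
    matrix [G] and matrices [dG i]. Change of chart and conformal change become matrix identities,
    into which the analysis feeds the Jacobian and the Hessian of the transition map. The normal
    derivative of f is never computed: a one-sided comparison with a single x_0 * b bounds it below
    by b. The prescribed form u^(p-2) of the conformal factor is met by u = expR (f / (p-2)), where
    p - 2 = 4 / (m-1). *)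

Lemma near_eq_differentiable V W (f g : V -> W) (x : V) :
  (\forall y \near x, f y = g y) -> differentiable f x -> differentiable g x.
Proof.
move=> fg /[dup] df /diff_locallyP[dc fE].
have fgx : f x = g x by exact: (nbhs_singleton fg).
suff gE : g \o shift x = cst (g x) + 'd f x +o_ (0 : V) id.
  by apply/diff_locallyP; rewrite (diff_unique dc gE).
apply/eqaddoP => e e0; move/eqaddoP : fE => /(_ e e0) fE.
have {}fg : \forall h \near (0 : V), f (h + x) = g (h + x).
  by move: fg; rewrite (near_shift 0) subr0.
by apply: filterS2 fE fg => h + fgh; rewrite -fgx !fctE /= fgh.
Qed.

(** Scaling, with [R^o] as the scalar space, is packed as a continuous bilinear map; the product
    rule is then the chain rule through the differential of that map. *)
Lemma is_diff_scale V W (k : V -> R) (G : V -> W) (dk : V -> R) (dG : V -> W) x :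
  is_diff x (k : V -> R^o) (dk : V -> R^o) -> is_diff x G dG ->
  is_diff x (fun y => k y *: G y) (fun v => k x *: dG v + dk v *: G x).
Proof.
move=> dk0 dG0.
have bil : bilinear_for (GRing.Scale.Law.clone _ _ *:%R _)
   (GRing.Scale.Law.clone _ _ *:%R _) (@GRing.scale R W : R^o -> W -> W).
  split=> [u|u]; first by move=> a x1 y1 /=; rewrite scalerDl scalerA.
  by move=> a x1 y1 /=; rewrite scalerDr !scalerA mulrC.
pose S : {bilinear R^o -> W -> W} :=
  HB.pack (@GRing.scale R W : R^o -> W -> W) (bilinear_isBilinear.Build _ _ _ _ _ _ _ bil).
have Sc : continuous (fun p => S p.1 p.2).
  by move=> p; exact: scale_continuous.
have dS : is_diff (k x, G x) (fun p : R^o * W => S p.1 p.2)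
   (fun q => S (k x) q.2 + S q.1 (G x)).
  by apply: DiffDef; [exact: differentiable_bilin|rewrite diff_bilin].
exact: (@is_diff_comp _ _ _ _ (fun y => ((k y : R^o), G y)) (fun y => ((dk y : R^o), dG y)) _ _ x _ dS).
Qed.

Lemma derive_scale V W (k : V -> R^o) (G : V -> W) x v :
  differentiable k x -> differentiable G x ->
  'D_v (fun y => k y *: G y) x = k x *: 'D_v G x + 'D_v k x *: G x.
Proof.
move=> dk dG.
have [] := is_diff_scale (differentiableP dk) (differentiableP dG).
by move=> d1 d2; rewrite !deriveE// d2.
Qed.

Lemma derive_linear V W W' (L : {linear W -> W'}) (f : V -> W) x v :
  continuous L -> differentiable f x ->
  differentiable (L \o f) x /\ 'D_v (L \o f) x = L ('D_v f x).
Proof.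
move=> Lc df; have dL : differentiable L (f x) by exact: linear_differentiable.
have dc : differentiable (L \o f) x by exact: differentiable_comp.
by split=> //; rewrite !deriveE// diff_comp//= diff_lin.
Qed.

Lemma derive_comp1 V (h : R -> R) (q : V -> R^o) x v (l : R) :
  is_derive (q x) 1 h l -> differentiable q x ->
  differentiable (h \o q : V -> R^o) x /\ 'D_v (h \o q : V -> R^o) x = l * 'D_v q x.
Proof.
move=> [/derivable1_diffP dh hE] dq.
have dc : differentiable (h \o q : V -> R^o) x by exact: differentiable_comp.
split=> //; rewrite !deriveE// diff_comp//= deriv1E; last exact/derivable1_diffP.
by rewrite derive1E hE mulrC.
Qed.

Lemma derive_comp_rV n V W (f : 'rV[R]_n.+1 -> W) (h : V -> 'rV[R]_n.+1) x v :
  differentiable h x -> differentiable f (h x) ->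
  differentiable (f \o h) x /\
  'D_v (f \o h) x =
  \sum_i 'D_v (fun y => h y ord0 i : R^o) x *: 'D_(delta_mx ord0 i) f (h x).
Proof.
move=> dh df; have dc : differentiable (f \o h) x by exact: differentiable_comp.
split=> //; rewrite !deriveE// diff_comp//=.
rewrite {1}(row_sum_delta ('d h x v)) linear_sum; apply: eq_bigr => i _.
rewrite linearZ /= -!deriveE//; congr (_ *: _).
rewrite derive_mx; first by rewrite mxE.
exact: diff_derivable.
Qed.

End Differentiation.

Section Ck.
Context {R : realType} {m : nat}.
Implicit Types (V W : normedModType R) (U : set 'rV[R]_m.+1).
Local Notation E := 'rV[R]_m.+1.

Lemma Ck_subset V k U U' (f : E -> V) : U' `<=` U -> Ck k U f -> Ck k U' f.
Proof.
move=> sU; elim: k f => [|k IH] f /=; first by move=> h x /sU/h.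
by move=> [h1 h2]; split=> [x /sU/h1//|i]; exact/IH/h2.
Qed.

(** On an open set, pointwise equality is equality near each point and so passes to derivatives. The
    closure properties below use it to replace a derivative by its explicit formula, which is valid
    only on [U]. *)
Lemma Ck_ext V k U (f g : E -> V) : open U ->
  (forall x, U x -> f x = g x) -> Ck k U f -> Ck k U g.
Proof.
move=> oU; elim: k f g => [|k IH] f g fg /=.
  move=> fc x Ux; have nU : nbhs x U by exact: open_nbhs_nbhs.
  have gf : {near x, f =1 g} by apply: filterS nU => y; exact: fg.
  rewrite /prop_for /continuous_at -(fg _ Ux).
  exact: cvg_trans (near_eq_cvg gf) (fc x Ux).
have near_fg x : U x -> \forall y \near x, f y = g y.
  move=> Ux; have nU : nbhs x U by exact: open_nbhs_nbhs.
  by apply: filterS nU => y; exact: fg.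
move=> [df Df]; split=> [x Ux|i].
  by apply: near_eq_differentiable (df _ Ux); exact: near_fg.
by apply: IH (Df i) => x Ux; apply: near_eq_derive; exact: near_fg.
Qed.

Lemma CkW V k U (f : E -> V) : Ck k.+1 U f -> Ck k U f.
Proof.
elim: k f => [|k IH] f [df Df].
  by move=> x Ux; exact/differentiable_continuous/df.
by split=> // i; exact: IH.
Qed.

Lemma Ck_cst V k U (a : V) : Ck k U (fun=> a).
Proof.
elim: k a => [|k IH] a /=; first by move=> x _; exact: cst_continuous.
split=> [x _|i]; first exact: differentiable_cst.
have -> : (fun x => 'D_(coord_vec i) (fun=> a) x) = (fun=> 0 : V).
  by apply/funext => x; exact: derive_cst.
exact: IH.
Qed.

Lemma CkD V k U (f g : E -> V) : open U ->
  Ck k U f -> Ck k U g -> Ck k U (fun x => f x + g x).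
Proof.
move=> oU; elim: k f g => [|k IH] f g /=.
  by move=> fc gc x Ux; apply: continuousD; [exact: fc|exact: gc].
move=> [df Df] [dg Dg]; split=> [x Ux|i].
  by apply: differentiableD; [exact: df|exact: dg].
apply: (@Ck_ext _ _ _ (fun x => 'D_(coord_vec i) f x + 'D_(coord_vec i) g x)) => //.
  by move=> x Ux; rewrite deriveD//; apply: diff_derivable; [exact: df|exact: dg].
exact: IH.
Qed.

Lemma Ck_scale V k U (l : E -> R^o) (f : E -> V) : open U ->
  Ck k U l -> Ck k U f -> Ck k U (fun x => l x *: f x).
Proof.
move=> oU; elim: k l f => [|k IH] l f.
  by move=> lc fc x Ux; exact: cvgZ (lc x Ux) (fc x Ux).
move=> /[dup] /CkW lk [dl Dl] /[dup] /CkW fk [df Df]; split=> [x Ux|i].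
  by have [] := is_diff_scale (differentiableP (dl _ Ux)) (differentiableP (df _ Ux)).
apply: (@Ck_ext _ _ _ (fun x => l x *: 'D_(coord_vec i) f x + 'D_(coord_vec i) l x *: f x)) => //.
  by move=> x Ux; rewrite derive_scale//; [exact: dl|exact: df].
by apply: CkD => //; [exact: IH lk (Df i)|exact: IH (Dl i) fk].
Qed.

Lemma Ck_linear V W k U (L : {linear V -> W}) (f : E -> V) : open U ->
  continuous L -> Ck k U f -> Ck k U (L \o f).
Proof.
move=> oU Lc; elim: k f => [|k IH] f /=.
  by move=> fc x Ux; apply: continuous_comp; [exact: fc|exact: Lc].
move=> [df Df]; split=> [x Ux|i]; first by have [] := derive_linear 0 Lc (df x Ux).
apply: (@Ck_ext _ _ _ (L \o (fun x => 'D_(coord_vec i) f x))) => //; last exact: IH.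
by move=> x Ux /=; have [_ ->] := derive_linear (coord_vec i) Lc (df x Ux).
Qed.

(** The chain rule gives [h' \o q] times a derivative of [q]. Since [h'] is again in the class [C],
    the induction on [k] closes without any iterated derivatives of [h]. It serves for the flat
    functions and for exponentials. *)
Lemma Ck_comp1 k U (C : set (R -> R)) (h : R -> R) (q : E -> R^o) : open U ->
  (forall h, C h -> exists2 h', C h' & forall t : R, is_derive t 1 h (h' t)) ->
  C h -> Ck k U q -> Ck k U (h \o q : E -> R^o).
Proof.
move=> oU hC; elim: k h => [|k IH] h Ch.
  move=> qc x Ux; apply: continuous_comp; first exact: qc.
  have [h' _ /(_ (q x))[/derivable1_diffP dh _]] := hC _ Ch.
  exact: differentiable_continuous.
move=> /[dup] /CkW qk [dq Dq]; have [h' Ch' hh'] := hC _ Ch; split=> [x Ux|i].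
  by have [] := derive_comp1 0 (hh' (q x)) (dq x Ux).
apply: (@Ck_ext _ _ _ (fun x => (h' \o q) x *: ('D_(coord_vec i) q x : R^o))) => //.
  by move=> x Ux; have [_ ->] := derive_comp1 (coord_vec i) (hh' (q x)) (dq x Ux).
by apply: Ck_scale => //; [exact: IH Ch' qk|exact: Dq].
Qed.

Lemma Ck_coord k U p q (f : E -> 'M[R]_(p, q)) i j : open U ->
  Ck k U f -> Ck k U (fun x => f x i j : R^o).
Proof.
move=> oU fk.
have lin : linear (fun M : 'M[R]_(p, q) => M i j : R^o).
  by move=> a x y; rewrite !mxE.
pose L : {linear 'M[R]_(p, q) -> R^o} :=
  HB.pack (fun M : 'M[R]_(p, q) => M i j : R^o) (GRing.isLinear.Build _ _ _ _ _ lin).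
by apply: (@Ck_linear _ _ _ _ L) => //; exact: coord_continuous.
Qed.

Lemma Ck_sum V k U (I : Type) (r : seq I) (F : I -> E -> V) : open U ->
  (forall i, Ck k U (F i)) -> Ck k U (fun x => \sum_(i <- r) F i x).
Proof.
move=> oU Fk; elim: r => [|a r IH].
  by apply: (@Ck_ext _ _ _ (fun=> 0)) (Ck_cst _ _ _) => // x _; rewrite big_nil.
apply: (@Ck_ext _ _ _ (fun x => F a x + \sum_(i <- r) F i x)) => //.
  by move=> x _; rewrite big_cons.
exact: CkD.
Qed.

Lemma Ck_comp V k U U' (f : E -> V) (h : E -> E) : open U -> open U' ->
  (forall x, U x -> U' (h x)) -> Ck k U' f -> Ck k U h -> Ck k U (f \o h).
Proof.
move=> oU oU' hU; elim: k f => [|k IH] f.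
  by move=> fc hc x Ux; apply: continuous_comp; [exact: hc|exact/fc/hU].
move=> [df Df] /[dup] /CkW hk [dh Dh]; split=> [x Ux|i].
  by apply: differentiable_comp; [exact: dh|exact/df/hU].
apply: (@Ck_ext _ _ _ (fun x => \sum_j ('D_(coord_vec i) h x ord0 j : R^o) *:
   ((fun y => 'D_(coord_vec j) f y) \o h) x)) => //.
  move=> x Ux; have [_ ->] := derive_comp_rV (coord_vec i) (dh _ Ux) (df _ (hU _ Ux)).
  apply: eq_bigr => j _; congr (_ *: _).
  by rewrite derive_mx ?mxE//; exact/diff_derivable/dh.
apply: Ck_sum => // j; by apply: Ck_scale => //; [apply: Ck_coord => //; exact: Dh|exact: IH (Df j) hk].
Qed.

End Ck.

(** * Bump functions *)

Section Bump.
Context {R : realType}.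

(* t |-> P(1/t) exp(-1/t): a family closed under differentiation. *)
Definition flat (P : {poly R}) (t : R) : R :=
  if 0 < t then P.[t^-1] * expR (- t^-1) else 0.

(** With s = 1/t >= 1, [|P.[s]|] is at most A * s^d, while the exponential series gives exp(-s) <=
    (d+2)! / s^(d+2). The two extra powers leave t^2, enough for the difference quotient at 0 to
    vanish. *)
Lemma flat_bound P : exists2 K, 0 <= K & forall t, t <= 1 -> `|flat P t| <= K * t ^+ 2.
Proof.
pose d := size P; pose A := \sum_(i < d) `|P`_i|.
have A0 : 0 <= A by apply: sumr_ge0.
exists (A * d.+2`!%:R); first by rewrite mulr_ge0.
move=> t t1; rewrite /flat; case: ifPn => t0; last first.
  by rewrite normr0; exact: mulr_ge0 (mulr_ge0 A0 (ler0n _ _)) (sqr_ge0 _).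
have s1 : 1 <= t^-1 by rewrite -invr1 lef_pV2 ?posrE.
have s0 : 0 < t^-1 by rewrite invr_gt0.
set s := t^-1 in s1 s0 *; have -> : t = s^-1 by rewrite /s invrK.
have PA : `|P.[s]| <= A * s ^+ d.
  rewrite horner_coef (le_trans (ler_norm_sum _ _ _))// mulr_suml ler_sum// => i _.
  rewrite normrM ler_wpM2l// normrX gtr0_norm// ler_weXn2l// ltnW//.
have ee : expR (- s) <= d.+2`!%:R / s ^+ d.+2.
  have p0 : 0 < s ^+ d.+2 / d.+2`!%:R.
    by rewrite divr_gt0// ?exprn_gt0// ltr0n fact_gt0.
  rewrite expRN -[leRHS]invf_div lef_pV2 ?posrE ?expR_gt0//.
  by apply: le_trans (expR_ge1Dxn d.+1 (ltW s0)); rewrite lerDr.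
rewrite normrM (gtr0_norm (expR_gt0 _)) (le_trans (ler_pM _ _ PA ee))// ?expR_ge0//.
by rewrite le_eqVlt -addn2 exprD; apply/orP; left; apply/eqP; field;
   rewrite expf_neq0 gt_eqF.
Qed.

(** For t > 0, differentiating P(1/t) exp(-1/t) brings out t^-2 * (P - P')(1/t), hence the new
    polynomial. At 0 both the value and the derivative are 0, by the quadratic bound. *)
Lemma is_derive_flat (P : {poly R}) (t : R) : is_derive t (1 : R) (flat P) (flat ('X^2 * (P - P^`())) t).
Proof.
have [t0|t0|->] := ltgtP t 0.
- rewrite {2}/flat ltNge ltW//=.
  apply: (@near_eq_is_derive _ _ _ (fun=> 0)).
  near=> y; rewrite /flat ltNge ltW//; near: y; exact: lt_nbhsl.
- rewrite {2}/flat t0.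
  have t0' : t != 0 by rewrite gt_eqF.
  have dV : is_derive t (1:R) (@GRing.inv R) (- t ^- 2).
    by have := is_deriveV t0' (is_derive_id t (1 : R)); rewrite [_ *: _]mulr1.
  have dP : is_derive t (1:R) (horner P \o @GRing.inv R) (P^`().[t^-1] * - t ^- 2).
    exact: is_derive1_comp.
  have dN : is_derive t (1:R) (fun t : R => - t^-1) (- - t ^- 2) by exact: is_deriveN.
  have dE : is_derive t (1:R) (expR \o (fun t : R => - t^-1)) (expR (- t^-1) * - - t ^- 2).
    exact: is_derive1_comp.
  have dM := is_deriveM dP dE.
  have fE : \forall y \near t, ((horner P \o @GRing.inv R) * (expR \o (fun t : R => - t^-1))) y = flat P y.
    by near=> y; rewrite /flat ifT//; near: y; exact: lt_nbhsr.
  have D := near_eq_is_derive fE dM.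
  apply: is_derive_eq D _.
  rewrite /= !hornerE -!exprVn /GRing.scale /=; ring.
- have [K K0 fK] := flat_bound P; rewrite {2}/flat ltxx.
  have cv : h^-1 *: (flat P (h *: (1:R) + 0) - flat P 0) @[h --> 0^'] --> (0 : R).
    apply/cvgrPdist_le => e e0; near=> h.
    have h0 : h != 0 by near: h; exact: nbhs_dnbhs_neq.
    rewrite sub0r normrN [flat P 0]/flat ltxx subr0 addr0 [_ *: 1]mulr1 normrM normfV.
    rewrite ler_pdivrMl ?normr_gt0//.
    have h1 : h <= 1.
      rewrite (le_trans (ler_norm _))//; near: h; exact: dnbhs0_le.
    apply: le_trans (fK _ h1) _; rewrite -(ger0_norm (sqr_ge0 h)) normrX expr2.
    rewrite mulrCA ler_wpM2l//.
    (* The quotient is at most K * |h|; dividing by [K + 1] avoids a separate case [K = 0]. *)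
    have : `|h| <= e / (K + 1) by near: h; apply: dnbhs0_le; rewrite divr_gt0// ltr_wpDl.
    rewrite ler_pdivlMr ?ltr_wpDl//; apply: le_trans.
    by rewrite mulrC ler_wpM2l// lerDl.
  apply: DeriveDef; first by apply/cvg_ex; exists 0.
  exact: cvg_lim cv.
Unshelve. all: by end_near. Qed.

End Bump.

Section BumpFunction.
Context {R : realType} {m : nat}.
Local Notation E := 'rV[R]_m.+1.

(** The norm on row vectors is the sup norm, which is not smooth. The squared Euclidean distance is
    polynomial and dominates the square of the sup norm, so the bump still vanishes outside the
    sup-norm ball. *)
Definition sqdist (x y : E) : R := \sum_i (y ord0 i - x ord0 i) ^+ 2.

Definition smooth_bump (x : E) (r : R) (y : E) : R := flat 1 (r ^+ 2 - sqdist x y).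

Lemma smooth_bump_ge0 x r y : 0 <= smooth_bump x r y.
Proof.
by rewrite /smooth_bump /flat; case: ifP => // _; rewrite hornerC mul1r expR_ge0.
Qed.

Lemma smooth_bump_center x r : 0 < r -> 0 < smooth_bump x r x.
Proof.
move=> r0; rewrite /smooth_bump /flat /sqdist big1 => [|i _]; last by rewrite subrr expr0n.
by rewrite subr0 exprn_gt0// hornerC mul1r expR_gt0.
Qed.

Lemma smooth_bump_out x r y : 0 < r -> r <= `|x - y| -> smooth_bump x r y = 0.
Proof.
move=> r0 rxy; rewrite /smooth_bump /flat ifF//; apply/negbTE; rewrite -leNgt subr_le0.
have xy0 : `|x - y| != 0 by rewrite gt_eqF// (lt_le_trans r0).
(* The sup norm is attained at a coordinate [j], whose single square already bounds [sqdist] from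
   below. *)
have [[i j] /= xyE] : exists ij, `|x - y| = `|(x - y) ij.1 ij.2| := mx_norm_neq0 xy0.
rewrite (ord1 i) !mxE in xyE; rewrite /sqdist (bigD1 j)//=.
rewrite (@le_trans _ _ ((y ord0 j - x ord0 j) ^+ 2))//.
  rewrite -[leRHS]real_normK ?num_real// distrC -xyE.
  by rewrite ler_sqr ?nnegrE ?normr_ge0 ?(ltW r0).
by rewrite lerDl sumr_ge0// => k _; exact: sqr_ge0.
Qed.

Lemma differentiable_coordinate (y : E) i : differentiable (fun y : E => y ord0 i : R^o) y.
Proof. exact: differentiable_coord. Qed.

Lemma derive_coordinate (y v : E) i : 'D_v (fun y : E => y ord0 i : R^o) y = v ord0 i.
Proof.
have did : derivable (@id E) y v.
  exact/diff_derivable/(@ex_diff _ _ _ _ _ _ _ (is_diff_id y)).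
by have /matrixP/(_ ord0 i) := derive_mx did; rewrite derive_id [RHS]mxE => ->.
Qed.

Lemma Ck_coordinate k i : Ck k setT (fun y : E => y ord0 i : R^o).
Proof.
case: k => [|k].
  by move=> y _; exact/differentiable_continuous/differentiable_coordinate.
split=> [y _|j]; first exact: differentiable_coordinate.
have -> : (fun y : E => 'D_(coord_vec j) (fun y : E => y ord0 i : R^o) y) =
    (fun=> coord_vec j ord0 i : R^o).
  by apply/funext => y; exact: derive_coordinate.
exact: Ck_cst.
Qed.

Lemma Ck_smooth_bump k x r : Ck k setT (fun y => smooth_bump x r y : R^o).
Proof.
pose q (y : E) : R^o := r ^+ 2 + \sum_i (- (y ord0 i + - x ord0 i)) *: (y ord0 i + - x ord0 i : R^o).
have -> : (fun y => smooth_bump x r y : R^o) = flat 1 \o q.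
  apply/funext => y; rewrite /smooth_bump /q /sqdist /= -sumrN; congr (flat _ (_ + _)).
  by apply: eq_bigr => i _; rewrite [_ *: _]mulNr expr2.
apply: (@Ck_comp1 _ _ _ _ (range (@flat R))) => //; first exact: openT.
- move=> _ [P _ <-]; exists (flat ('X^2 * (P - P^`()))); first by exists ('X^2 * (P - P^`())).
  by move=> t; exact: is_derive_flat.
- apply: CkD; [exact: openT|exact: Ck_cst|].
  apply: Ck_sum; [exact: openT|move=> i].
  have Ci : Ck k setT (fun y : E => y ord0 i + - x ord0 i : R^o).
    by apply: CkD; [exact: openT|exact: Ck_coordinate|exact: Ck_cst].
  apply: Ck_scale => //; first exact: openT.
  have -> : (fun y : E => - (y ord0 i + - x ord0 i) : R^o) =
     (fun y : E => ((-1 : R^o)) *: (y ord0 i + - x ord0 i : R^o)).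
    by apply/funext => y; rewrite scaleN1r.
  by apply: Ck_scale => //; [exact: openT|exact: Ck_cst].
Qed.

End BumpFunction.

(** * One-sided partial derivatives and symmetry of second derivatives *)

Section Partial.
Context {R : realType} {m : nat}.
Local Notation E := 'rV[R]_m.+1.

Lemma half_space_line (x : E) i t :
  half_space x -> (i != ord0) || (0 <= t) -> half_space (x + t *: coord_vec i).
Proof.
rewrite /half_space /= !mxE eqxx /= eq_sym; case: eqVneq => [_|_] /= x0 t0.
  by rewrite mulr1 addr_ge0.
by rewrite mulr0 addr0.
Qed.

Lemma quotient_cvg (U : set E) (F : E -> R^o) (f : E -> R) i x (G : set_system R) :
  Filter G -> G --> (0 : R)^' -> (\forall t \near G, half_space (x + t *: coord_vec i)) ->
  open U -> U x -> half_space x -> (forall y, U y -> half_space y -> F y = f y) ->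
  differentiable F x ->
  (fun t : R => t^-1 * (f (x + t *: coord_vec i) - f x)) @ G --> 'D_(coord_vec i) F x.
Proof.
move=> FG G0 GH oU Ux Hx Ff dF.

have dv : (fun t : R => t^-1 *: (F (t *: coord_vec i + x) - F x)) @ G --> 'D_(coord_vec i) F x.
  by apply: cvg_trans (diff_derivable dF); exact: cvg_app.
apply: cvg_trans dv; apply: near_eq_cvg.
have GU : \forall t \near G, U (x + t *: coord_vec i).
  apply: G0; apply: nbhs_dnbhs.
  have : (fun t : R => x + t *: coord_vec i) @ (0 : R) --> x + (0 : R) *: coord_vec i.
    by apply: cvgD; [exact: cvg_cst|apply: cvgZr_tmp; exact: cvg_id].
  by rewrite scale0r addr0; apply; exact: open_nbhs_nbhs.
by apply: filterS2 GH GU => t Ht Ut /=; rewrite (addrC _ x) !Ff.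
Qed.

Lemma at_right0_dnbhs : (0 : R)^'+ --> (0 : R)^'.
Proof.
move=> A A0; have A1 : \forall t \near (0 : R), t != 0 -> A t := A0.
have : \forall t \near (0 : R), 0 < t -> A t; last by [].
by apply: filterS A1 => t At t0; apply: At; rewrite gt_eqF.
Qed.

(** Small positive steps never leave the half-space, even in the normal direction at a boundary
    point. Properness makes the limit in [partial] unique, so that [cvg_lim] can evaluate it. *)
Lemma within_half_proper (x : E) i : half_space x ->
  ProperFilter (within [set t | half_space (x + t *: coord_vec i)] (0 : R)^').
Proof.
move=> Hx; apply: Build_ProperFilter_ex => B /= BW.
have /filter_ex[t] : \forall t \near (0 : R)^'+, B t.
  have := at_right0_dnbhs BW; apply: filterS2 (nbhs_right_gt 0) => t t0; apply.
  by apply: half_space_line => //; rewrite ltW// orbT.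
by exists t.
Qed.

(** The bridge from the definitions to differential calculus: the extension [F] need agree with [f]
    only on the half-space, because the increments in [partial] see nothing else. *)
Lemma partialE (U : set E) (F : E -> R^o) (f : E -> R) i x :
  open U -> U x -> half_space x -> (forall y, U y -> half_space y -> F y = f y) ->
  differentiable F x -> partial f i x = 'D_(coord_vec i) F x.
Proof.
move=> oU Ux Hx Ff dF; have PF := within_half_proper i Hx.
apply: cvg_lim => //; apply: (quotient_cvg _ _ _ oU) => //.
  exact: cvg_within.
exact: withinT.
Qed.

Lemma is_derive_line (f : E -> R^o) (a v : E) (s : R) : differentiable f (a + s *: v) ->
  is_derive s (1 : R) (fun s : R => f (a + s *: v) : R) ('D_v f (a + s *: v)).
Proof.
move=> df; have cv : (fun h : R => h^-1 *: (f (a + (h *: (1 : R) + s) *: v) - f (a + s *: v)))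
    @ (0 : R)^' --> 'D_v f (a + s *: v).
  rewrite (_ : (fun h => _) =
    (fun h => h^-1 *: ((f \o shift (a + s *: v)) (h *: v) - f (a + s *: v)))).
    exact: (@diff_derivable _ _ _ _ _ v df).
  apply/funext => h; congr (_ *: (f _ - _)).
  by rewrite /= [_ *: 1]mulr1 scalerDl addrCA.
by apply: DeriveDef; [apply/cvg_ex; eexists; exact: cv|exact: cvg_lim cv].
Qed.

(** The mean value theorem is applied twice: to the difference of [f] along two parallel segments in
    direction [i], then to the [i]-derivative along direction [j]. The left-hand side is symmetric
    in [i] and [j], whereas the right-hand side exchanges the order of differentiation. *)
Lemma second_difference (U : set E) (f : E -> R^o) i j (x : E) (t : R) : 0 < t ->
  Ck 2 U f ->
  (forall s u, 0 <= s <= t -> 0 <= u <= t -> U (x + s *: coord_vec i + u *: coord_vec j)) ->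
  exists s u, [/\ 0 <= s <= t, 0 <= u <= t &
   f (x + t *: coord_vec i + t *: coord_vec j) - f (x + t *: coord_vec i)
   - f (x + t *: coord_vec j) + f x =
   'D_(coord_vec j) ('D_(coord_vec i) f) (x + s *: coord_vec i + u *: coord_vec j) * t * t].
Proof.
move=> t0 [df /(_ i)[d2f _]] hU.
have tt : 0 <= t <= t by rewrite lexx ltW.
have t00 : 0 <= (0 : R) <= t by rewrite lexx ltW.
pose phi (s : R) : R := f (x + t *: coord_vec j + s *: coord_vec i) - f (x + s *: coord_vec i).
pose dphi (s : R) : R := 'D_(coord_vec i) f (x + t *: coord_vec j + s *: coord_vec i)
   - 'D_(coord_vec i) f (x + s *: coord_vec i).
have dp s : 0 <= s <= t -> is_derive s (1 : R) phi (dphi s).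
  move=> st; apply: is_deriveB; apply: is_derive_line; apply: df.
    by rewrite addrAC; exact: hU.
  by have := hU _ _ st t00; rewrite scale0r addr0.
have [||s] := @MVT R phi dphi 0 t t0.
- by move=> s; rewrite in_itv/= => /andP[s0 st]; apply: dp; rewrite !ltW.
- apply: derivable_within_continuous => s; rewrite in_itv/= => /dp[+ _]; exact.
rewrite in_itv/= => /andP[/ltW s0 /ltW st] phiE.
have s0t : 0 <= s <= t by rewrite s0 st.
pose psi (u : R) : R := 'D_(coord_vec i) f (x + s *: coord_vec i + u *: coord_vec j).
pose dpsi (u : R) : R := 'D_(coord_vec j) ('D_(coord_vec i) f) (x + s *: coord_vec i + u *: coord_vec j).
have dq u : 0 <= u <= t -> is_derive u (1 : R) psi (dpsi u).
  by move=> ut; apply: is_derive_line; apply: d2f; exact: hU.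
have [||u] := @MVT R psi dpsi 0 t t0.
- by move=> u; rewrite in_itv/= => /andP[u0 ut]; apply: dq; rewrite !ltW.
- apply: derivable_within_continuous => u; rewrite in_itv/= => /dq[+ _]; exact.
rewrite in_itv/= => /andP[/ltW u0 /ltW ut] psiE.
exists s, u; split=> //; first by rewrite u0 ut.
rewrite subr0 in psiE phiE; rewrite -/(dpsi u) -psiE.
have <- : dphi s = psi t - psi 0.
  by rewrite /psi /dphi scale0r addr0 [x + _ + _]addrAC.
rewrite -phiE /phi scale0r !addr0 (addrAC x); ring.
Qed.

Lemma dist_half (e a b c : R) : `|a - c| <= e / 2 -> `|b - c| <= e / 2 -> `|a - b| <= e.
Proof.
move=> ac bc; rewrite (splitr e) (le_trans (ler_distD c _ _))//.
by rewrite lerD// distrC.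
Qed.

Lemma schwarz (U : set E) (f : E -> R^o) i j (x : E) : open U -> U x -> Ck 2 U f ->
  'D_(coord_vec i) ('D_(coord_vec j) f) x = 'D_(coord_vec j) ('D_(coord_vec i) f) x.
Proof.
move=> oU Ux fC; apply/eqP; rewrite -subr_eq0 -normr_le0.
apply/ler_addgt0Pl => e e0; rewrite addr0.
have ctn k l : {for x, continuous ('D_(coord_vec k) ('D_(coord_vec l) f))}.
  by case: fC => _ /(_ l)[_ /(_ k)]; apply.
have e20 : 0 < e / 2 by rewrite divr_gt0.
pose A := coord_vec i : E; pose B := coord_vec j : E.
have : \forall y \near x, [/\ U y,
   `|'D_A ('D_B f) x - 'D_A ('D_B f) y| <= e / 2 &
   `|'D_B ('D_A f) x - 'D_B ('D_A f) y| <= e / 2].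
  have C1 : \forall y \near x, `|'D_A ('D_B f) x - 'D_A ('D_B f) y| <= e / 2.
    by move/cvgrPdist_le : (ctn i j) => /(_ _ e20).
  have C2 : \forall y \near x, `|'D_B ('D_A f) x - 'D_B ('D_A f) y| <= e / 2.
    by move/cvgrPdist_le : (ctn j i) => /(_ _ e20).
  have nU : nbhs x U by exact: open_nbhs_nbhs.
  near=> y; split; [exact: (near nU y)|exact: (near C1 y)|exact: (near C2 y)].
move=> /nbhs_ballP[r /= r0 rP].
pose N := `|A| + `|B| + 1; have N0 : 0 < N by rewrite ltr_wpDl// addr_ge0.
(* Small enough for the whole parallelogram spanned by [t *: A] and [t *: B] at [x] to lie in the
   ball where both mixed derivatives are within e/2 of their values at [x]. *)
pose t := r / N / 2.
have t0 : 0 < t by rewrite !divr_gt0.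
have tN : t * (`|A| + `|B|) < r.
  rewrite /t -mulrA mulrAC ltr_pdivrMr// ltr_pM2l// mulrC.
  rewrite (@le_lt_trans _ _ (`|A| + `|B|))// ?ltrDl//.
  by rewrite ler_piMr// ?addr_ge0// invf_le1// ler1n.
have hB s u : 0 <= s <= t -> 0 <= u <= t -> ball x r (x + s *: A + u *: B).
  move=> /andP[s0 st] /andP[u0 ut]; rewrite -ball_normE /ball_ /=.
  rewrite -addrA opprD addrA subrr sub0r normrN (le_lt_trans (ler_normD _ _))//.
  rewrite !normrZ !ger0_norm// (le_lt_trans _ tN)// mulrDr lerD// ler_wpM2r//.
have [|s [u [st ut E1]]] := @second_difference U f i j x t t0 fC.
  by move=> s u st ut; have [] := rP _ (hB _ _ st ut).
have hB' p q : 0 <= p <= t -> 0 <= q <= t -> ball x r (x + p *: B + q *: A).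
  by move=> pt qt; rewrite addrAC; exact: hB.
have [|s' [u' [st' ut' E2]]] := @second_difference U f j i x t t0 fC.
  by move=> p q pt qt; have [] := rP _ (hB' _ _ pt qt).
have [_ _ P1] := rP _ (hB _ _ st ut).
have [_ P2 _] := rP _ (hB' _ _ st' ut').
(* Both sides, multiplied by t * t, are the same second difference. *)
have EE : 'D_B ('D_A f) (x + s *: A + u *: B) = 'D_A ('D_B f) (x + s' *: B + u' *: A).
  apply: (mulIf (lt0r_neq0 t0)); apply: (mulIf (lt0r_neq0 t0)).
  apply: (etrans (esym E1)); apply: etrans _ E2.
  by rewrite (addrAC x) (addrAC (f _)).
rewrite EE in P1; rewrite -/A -/B.
exact: dist_half P2 P1.
Unshelve. all: by end_near. Qed.

End Partial.

(** * The mean curvature as a function of the 1-jet of the metric *)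

Section Jets.
Context {R : realType} {m : nat}.
Local Notation n := m.+1.
Implicit Types (G A J : 'M[R]_n) (dG : 'I_n -> 'M[R]_n).

Definition posdef p (A : 'M[R]_p) :=
  forall v : 'rV[R]_p, v != 0 -> 0 < (v *m A *m v^T) ord0 ord0.

Lemma invmxM p (A B : 'M[R]_p) : A \in unitmx -> B \in unitmx ->
  invmx (A *m B) = invmx B *m invmx A.
Proof.
move=> Au Bu; have ABu : A *m B \in unitmx by rewrite unitmx_mul Au Bu.
apply: (can_inj (mulKmx ABu)).
by rewrite mulmxV// -mulmxA (mulmxA B) mulmxV// mul1mx mulmxV.
Qed.

Lemma posdef_unit p (A : 'M[R]_p) : posdef A -> A \in unitmx.
Proof.
move=> Ap; rewrite -row_free_unit -kermx_eq0; apply/negPn/negP => /rowV0Pn[v].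
move=> /sub_kermxP vA v0; have := Ap v v0.
by rewrite vA mul0mx mxE ltxx.
Qed.

(** With r the [i]-th row of the inverse, the value r A r^T of the quadratic form is exactly this
    diagonal entry. *)
Lemma posdef_inv_diag A i : A^T = A -> posdef A -> 0 < invmx A i i.
Proof.
move=> As Ap; have Au := posdef_unit Ap.
have r0 : row i (invmx A) != 0.
  apply: contraTneq (oner_neq0 R) => r0; apply/negPn/eqP.
  have := congr1 (fun B : 'rV_n => (B *m A) ord0 i) r0.
  by rewrite -row_mul mulVmx// mul0mx !mxE eqxx.
have := Ap _ r0; rewrite -row_mul mulVmx// row1 -rowE.
by rewrite !mxE.
Qed.

Definition tangential G : 'M[R]_m := \matrix_(a, b) G (lift ord0 a) (lift ord0 b).

Lemma posdef_tangential G : posdef G -> posdef (tangential G).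
Proof.
move=> Gp v v0; pose w : 'rV[R]_n := \row_j (if unlift ord0 j is Some a then v ord0 a else 0).
have wl a : w ord0 (lift ord0 a) = v ord0 a by rewrite mxE liftK.
have w00 : w ord0 ord0 = 0 by rewrite mxE unlift_none.
have w0 : w != 0.
  apply: contraNneq v0 => w0; apply/eqP/rowP => a.
  by rewrite -wl w0 !mxE.
have := Gp _ w0; congr (0 < _).
rewrite mxE big_ord_recl [w^T _ _]mxE w00 mulr0 add0r [RHS]mxE.
apply: eq_bigr => a _; rewrite [w^T _ _]mxE wl [v^T _ _]mxE; congr (_ * _).
rewrite mxE big_ord_recl w00 mul0r add0r [RHS]mxE.
by apply: eq_bigr => b _; rewrite wl [tangential _ _ _]mxE.
Qed.

(* Twice the Christoffel symbol with upper index 0, from the 1-jet of the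
   metric at a point. *)
Definition chr G dG a b : R :=
  \sum_l invmx G ord0 l * (dG a b l + dG b a l - dG l a b).

(** Twice the trace of h^-1 * Gamma^0. Its arguments are matrices at one point, not functions, so
    that its transformation laws are linear algebra. *)
Definition jet_curv G dG : R :=
  \tr (invmx (tangential G) *m
       \matrix_(a, b) chr G dG (lift ord0 a) (lift ord0 b)).

(** [N] is the row g^{0l}, the gradient of x_0. In this form the derivative terms are matrix
    products with [N^T], to which the transformation of [N] applies directly. *)
Lemma chrE G dG a b : let N := row ord0 (invmx G) in
  chr G dG a b = (dG a *m N^T) b ord0 + (dG b *m N^T) a ord0
    - \sum_l N ord0 l * dG l a b.
Proof.
rewrite /chr !mxE -big_split -sumrB; apply: eq_bigr => l _ /=.
by rewrite !mxE; ring.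
Qed.

Section Transform.
(** The data of a chart change at a boundary point: [J] is the Jacobian and [A i] its derivative in
    direction [i], that is, the Hessian. [dGcE] is [GcE] differentiated, [As] is Schwarz's theorem,
    and [J0] and [A0] hold because the new normal coordinate vanishes on the old boundary face. *)
Variables (Gc Gd J : 'M[R]_n) (dGc dGd A : 'I_n -> 'M[R]_n).
Hypotheses (Gcu : Gc \in unitmx) (Gds : Gd^T = Gd) (Gdu : Gd \in unitmx).
Hypothesis GcE : Gc = J *m Gd *m J^T.
Hypothesis dGcE : forall i, dGc i = A i *m Gd *m J^T
  + J *m (\sum_k J i k *: dGd k) *m J^T + J *m Gd *m (A i)^T.
Hypothesis As : forall i j k, A i j k = A j i k.
Hypothesis A0 : forall i j, i != ord0 -> j != ord0 -> A i j ord0 = 0.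
Hypothesis J0 : forall i, i != ord0 -> J i ord0 = 0.

Local Notation N := (row ord0 (invmx Gc)).
Local Notation M := (row ord0 (invmx Gd)).

Lemma jacobian_unit : J \in unitmx.
Proof. by move: Gcu; rewrite GcE !unitmx_mul => /andP[/andP[]]. Qed.

(* J_00 * (N * J) = M says that the differentials of the two normal coordinates
   are proportional along the boundary. *)
Lemma conormal_transform : J ord0 ord0 *: (N *m J) = M.
Proof.
have Ju := jacobian_unit.
apply: (can_inj (mulmxK Gdu)); rewrite -(row_mul _ (invmx Gd)) mulVmx//.
have JTu : J^T \in unitmx by rewrite unitmx_tr.
apply: (can_inj (mulmxK JTu)).
rewrite -!scalemxAl -!mulmxA (mulmxA J) -GcE -row_mul mulVmx// -row_mul mul1mx.
apply/rowP => k; rewrite !mxE eq_sym.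
have [->|k0] := eqVneq k ord0; first by rewrite mulr1.
by rewrite (J0 k0) mulr0.
Qed.

Lemma Gd_conormal : Gd *m M^T = delta_mx ord0 ord0 :> 'cV_n.
Proof.
have -> : Gd *m M^T = (M *m Gd)^T by rewrite trmx_mul Gds.
by rewrite -row_mul mulVmx// row1 trmx_delta.
Qed.

(** Symmetry of second derivatives enters here: it exchanges the contracted index [l] with [i],
    turning a Hessian term of the subtracted sum in [chrE] into one produced by the other two
    terms. *)
Let sum_A i j : \sum_l N ord0 l * (A l *m Gd *m J^T) i j = (J *m Gd *m (A i)^T *m N^T) j ord0.
Proof.
have -> : J *m Gd *m (A i)^T *m N^T = (N *m (A i *m Gd *m J^T))^T.
  by rewrite !trmx_mul trmxK Gds !mulmxA.
rewrite mxE [RHS]mxE.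
apply: eq_bigr => l _; congr (_ * _); rewrite -!mulmxA [LHS]mxE [RHS]mxE.
by apply: eq_bigr => k _; rewrite As.
Qed.

Lemma chr_transform a b : a != ord0 -> b != ord0 ->
  J ord0 ord0 * chr Gc dGc a b = \sum_k \sum_l J a k * J b l * chr Gd dGd k l.
Proof.
move=> a0 b0; rewrite chrE; set j := J ord0 ord0.
(* Of the three terms of [dGcE], the first becomes column 0 of [A i] by [conormal_transform] and
   [Gd_conormal], which vanishes in tangential rows by [A0]; the second is tensorial; the third is
   kept for cancellation. *)
have T1 i k : i != ord0 -> k != ord0 -> j * (dGc i *m N^T) k ord0 =
    \sum_q \sum_l J i q * J k l * (dGd q *m M^T) l ord0
    + j * (J *m Gd *m (A i)^T *m N^T) k ord0.
  move=> i0 k0; rewrite dGcE !mulmxDl [(_ + _ : 'cV_n) k ord0]mxE mulrDr; congr (_ + _).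
  rewrite [LHS](_ : _ = (A i *m (Gd *m M^T)) k ord0 + (J *m ((\sum_k J i k *: dGd k) *m M^T)) k ord0).
    rewrite Gd_conormal -colE mxE A0// add0r mxE exchange_big /=.
    apply: eq_bigr => l _; rewrite mulmx_suml summxE mulr_sumr.
    by apply: eq_bigr => q _; rewrite -scalemxAl [X in _ * X]mxE; ring.
  rewrite -conormal_transform linearZ /= trmx_mul -!scalemxAr.
  rewrite ![(_ *: _ : 'cV_n) k ord0]mxE [(_ + _ : 'cV_n) k ord0]mxE -/j mulrDr.
  by rewrite !mulmxA.
(* The two Hessian terms appearing here are those that [T1] leaves for the pairs (a, b) and (b,
   a). *)
have T3 : j * (\sum_l N ord0 l * dGc l a b) =
    \sum_q \sum_l J a q * J b l * (\sum_s M ord0 s * dGd s q l)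
    + j * (J *m Gd *m (A a)^T *m N^T) b ord0 + j * (J *m Gd *m (A b)^T *m N^T) a ord0.
  have sumM (X : 'I_n -> R) : j * (\sum_l N ord0 l * \sum_k J l k * X k)
      = \sum_k M ord0 k * X k.
    rewrite -conormal_transform mulr_sumr; under eq_bigr do rewrite !mulr_sumr.
    rewrite exchange_big; apply: eq_bigr => k _ /=.
    rewrite [X in _ = X * _]mxE [X in _ = _ * X * _]mxE mulr_sumr mulr_suml.
    by apply: eq_bigr => l _; rewrite -/j; ring.
  have entry k q l : (J *m dGd k *m J^T) q l = \sum_p \sum_s J q p * J l s * dGd k p s.
    rewrite mxE exchange_big; apply: eq_bigr => s _ /=; rewrite !mxE mulr_suml.
    by apply: eq_bigr => p _; ring.
  rewrite -!sum_A (_ : \sum_l N ord0 l * dGc l a b =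
    \sum_l N ord0 l * (\sum_k J l k * (J *m dGd k *m J^T) a b)
    + \sum_l N ord0 l * (A l *m Gd *m J^T) a b + \sum_l N ord0 l * (A l *m Gd *m J^T) b a).
    rewrite !mulrDr sumM; congr (_ + _ + _).
    under eq_bigr => k _.
      rewrite entry mulr_sumr; under eq_bigr do rewrite mulr_sumr; over.
    rewrite exchange_big; apply: eq_bigr => p _ /=.
    rewrite exchange_big; apply: eq_bigr => s _ /=.
    by rewrite mulr_sumr; apply: eq_bigr => k _; ring.
  rewrite -!big_split; apply: eq_bigr => l _ /=; rewrite -!mulrDr; congr (_ * _).
  rewrite dGcE [LHS]mxE [X in X + _ = _]mxE (addrC ((A l *m _ *m _) a b)).
  congr (_ + _ + _).
    rewrite mulmx_sumr mulmx_suml summxE; apply: eq_bigr => k _.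
    by rewrite -scalemxAr -scalemxAl mxE.
  have -> : J *m Gd *m (A l)^T = (A l *m Gd *m J^T)^T by rewrite !trmx_mul trmxK Gds mulmxA.
  by rewrite mxE.
rewrite mulrBr mulrDr T1// T1// T3.
set X1 := _ * (J *m _ *m (A a)^T *m _) _ _; set X2 := _ * (J *m _ *m (A b)^T *m _) _ _.
set S1 := \sum_q \sum_l _; set S2 := \sum_q \sum_l _; set S3 := \sum_q \sum_l _.
have -> : S1 + X1 + (S2 + X2) - (S3 + X1 + X2) = S1 + S2 - S3 by ring.
rewrite {}/S1 {}/S2 {}/S3 [X in _ + X - _]exchange_big -big_split -sumrB.
apply: eq_bigr => q _ /=; rewrite -big_split -sumrB; apply: eq_bigr => l _ /=.
by rewrite chrE /=; ring.
Qed.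

(** [J0] makes [J] block triangular, so no normal index survives in the tangential block. *)
Lemma tangential_transform : tangential Gc =
  tangential J *m tangential Gd *m (tangential J)^T.
Proof.
rewrite GcE; apply/matrixP => a b; rewrite [LHS]mxE [LHS]mxE [RHS]mxE.
rewrite big_ord_recl [J^T _ _]mxE (J0 (isT : lift ord0 b != ord0)) mulr0 add0r.
apply: eq_bigr => q _; rewrite [J^T _ _]mxE [(tangential J)^T _ _]mxE.
rewrite [tangential J _ _]mxE; congr (_ * _); rewrite [LHS]mxE [RHS]mxE.
rewrite big_ord_recl (J0 (isT : lift ord0 a != ord0)) mul0r add0r.
by apply: eq_bigr => p _; rewrite !mxE.
Qed.

(** With T the tangential block of [J], cyclicity of the trace cancels T and its transpose in tr((T
    k T^T)^-1 T X T^T); the only trace of the chart change is the factor [J ord0 ord0] from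
    [chr_transform]. *)
Lemma jet_curv_transform : tangential Gc \in unitmx ->
  J ord0 ord0 * jet_curv Gc dGc = jet_curv Gd dGd.
Proof.
move=> tu; rewrite /jet_curv.
set Xc := \matrix_(a, b) chr Gc _ _ _; set Xd := \matrix_(a, b) chr Gd _ _ _.
set h := tangential Gc; set k := tangential Gd; set T := tangential J.
have hE : h = T *m k *m T^T by exact: tangential_transform.
have XE : J ord0 ord0 *: Xc = T *m Xd *m T^T.
  apply/matrixP => a b; rewrite !mxE chr_transform//.
  rewrite big_ord_recl J0// [X in X + _]big1 ?add0r => [|l _]; last by rewrite !mul0r.
  under [RHS]eq_bigr do rewrite mxE mulr_suml.
  rewrite [RHS]exchange_big; apply: eq_bigr => p _ /=.
  rewrite big_ord_recl J0// mulr0 mul0r add0r; apply: eq_bigr => q _.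
  by rewrite !mxE; ring.
move: tu; rewrite -/h hE !unitmx_mul unitmx_tr => /andP[/andP[Tu ku] _].
rewrite -mxtraceZ scalemxAr XE !invmxM ?unitmx_mul ?unitmx_tr ?Tu ?ku//.
rewrite !mulmxA mxtrace_mulC !mulmxA mulmxV ?unitmx_tr// mul1mx.
by rewrite mulmxKV.
Qed.

End Transform.

(** [mu] is the gradient of a conformal factor whose value at the point is 1. Being purely normal,
    it contributes only through the subtracted derivative, with l = 0. *)
Lemma chr_conformal G dG (mu : 'I_n -> R) a b : (forall i, i != ord0 -> mu i = 0) ->
  a != ord0 -> b != ord0 ->
  chr G (fun i => mu i *: G + dG i) a b =
  chr G dG a b - invmx G ord0 ord0 * mu ord0 * G a b.
Proof.
move=> mu0 a0 b0; rewrite /chr.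
have -> : \sum_l invmx G ord0 l * ((mu a *: G + dG a) b l + (mu b *: G + dG b) a l
    - (mu l *: G + dG l) a b) =
  \sum_l (invmx G ord0 l * (dG a b l + dG b a l - dG l a b)
     - invmx G ord0 l * mu l * G a b).
  by apply: eq_bigr => l _; rewrite !mxE (mu0 a a0) (mu0 b b0); ring.
rewrite sumrB; congr (_ - _); rewrite big_ord_recl big1 ?addr0// => l _.
by rewrite mu0// mulr0 mul0r.
Qed.

Lemma jet_curv_conformal G dG (mu : 'I_n -> R) : (forall i, i != ord0 -> mu i = 0) ->
  tangential G \in unitmx ->
  jet_curv G (fun i => mu i *: G + dG i) =
  jet_curv G dG - m%:R * (invmx G ord0 ord0 * mu ord0).
Proof.
move=> mu0 tu; rewrite /jet_curv; set l := _ * mu ord0.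
rewrite (_ : \matrix_(a, b) _ = (\matrix_(a, b) chr G dG (lift ord0 a) (lift ord0 b))
   - l *: tangential G); last first.
  by apply/matrixP => a b; rewrite !mxE chr_conformal.
by rewrite mulmxBr -scalemxAr mulVmx// raddfB /= mxtraceZ mxtrace1 mulrC.
Qed.

End Jets.

Section CoordinateJets.
Context {R : realType} {m : nat}.
Local Notation E := 'rV[R]_m.+1.
Implicit Types (G : E -> 'M[R]_m.+1) (x : E).

Definition metric_jet G x i : 'M[R]_m.+1 :=
  \matrix_(k, l) partial (fun y => G y k l) i x.

Lemma christoffel_chr G i j x :
  christoffel G ord0 i j x = 2^-1 * chr (G x) (metric_jet G x) i j.
Proof.
by congr (_ * _); apply: eq_bigr => l _; rewrite !mxE.
Qed.

(** Lowering the index of the normal -g^{0l} / sqrt(g^00) gives a multiple of dx_0, so only the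
    Christoffel symbol with upper index 0 remains. The minus signs of the normal and of the second
    fundamental form cancel; the 1/2 is due to [chr] being twice that symbol. *)
Lemma coord_mean_curvatureE G x : (G x)^T = G x -> posdef (G x) ->
  coord_mean_curvature G x =
  m%:R^-1 * (2^-1 * (Num.sqrt (invmx (G x) ord0 ord0))^-1) * jet_curv (G x) (metric_jet G x).
Proof.
move=> Gs /posdef_unit Gu; rewrite /coord_mean_curvature -mulrA; congr (_ * _).
set s := Num.sqrt _; rewrite /jet_curv -mxtraceZ scalemxAr; congr (\tr (_ *m _)).
apply/matrixP => a b; rewrite mxE [RHS]mxE [X in _ = _ * X]mxE.
set i := lift ord0 a; set j := lift ord0 b.
transitivity (s^-1 * \sum_k christoffel G k i j x * (G x *m (invmx (G x))^T) k ord0).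
  rewrite mulr_sumr -sumrN; apply: eq_bigr => k _.
  rewrite mxE !mulr_sumr -sumrN; apply: eq_bigr => l _.
  by rewrite /outward_normal !mxE -/s; ring.
have -> : G x *m (invmx (G x))^T = 1%:M.
  by rewrite -[X in X *m _]Gs -trmx_mul mulVmx// trmx1.
under eq_bigr do rewrite mxE.
rewrite (bigD1 ord0)//= big1 ?addr0 => [|k /negPf k0]; last by rewrite k0 mulr0.
by rewrite mulr1 christoffel_chr mulrA (mulrC s^-1).
Qed.

Lemma coord_mean_curvature_lt0 G x : (0 < m)%N -> (G x)^T = G x -> posdef (G x) ->
  (coord_mean_curvature G x < 0) = (jet_curv (G x) (metric_jet G x) < 0).
Proof.
move=> m0 Gs Gp; rewrite coord_mean_curvatureE// pmulr_rlt0//.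
rewrite mulr_gt0 ?invr_gt0 ?ltr0n// mulr_gt0 ?invr_gt0 ?ltr0n//.
by rewrite sqrtr_gt0 posdef_inv_diag.
Qed.

Lemma metric_jetE (U : set E) (F G : E -> 'M[R]_m.+1) x i :
  open U -> U x -> half_space x -> (forall y, U y -> half_space y -> F y = G y) ->
  differentiable F x -> metric_jet G x i = 'D_(coord_vec i) F x.
Proof.
move=> oU Ux Hx FG dF; rewrite derive_mx; last exact: diff_derivable.
apply/matrixP => k l; rewrite !mxE.
have dFkl : differentiable (fun y => F y k l : R^o) x.
  exact: (@differentiable_comp _ _ _ _ F (fun N : 'M[R]_m.+1 => N k l : R^o) x dF
            (differentiable_coord _ _ _)).
have FGkl y : U y -> half_space y -> (F y k l : R^o) = G y k l.
  by move=> Uy Hy; rewrite FG.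
exact: etrans (partialE i oU Ux Hx FGkl dFkl) _.
Qed.

End CoordinateJets.

(** * Continuity of the inverse matrix and of the curvature trace *)

Section ContinuousMatrices.
Context {R : realType} {T : topologicalType}.
Variable x : T.

Lemma continuous_at_sum (I : Type) (r : seq I) (P : pred I) (F : I -> T -> R) :
  (forall i, P i -> {for x, continuous (F i)}) ->
  {for x, continuous (fun y => \sum_(i <- r | P i) F i y)}.
Proof.
move=> Fc; elim: r => [|a r IH].
  rewrite /prop_for; under eq_fun do rewrite big_nil; exact: cst_continuous.
rewrite /prop_for; under eq_fun do rewrite big_cons; case: ifPn => // Pa.
by apply: continuousD; [exact: Fc|exact: IH].
Qed.

Lemma continuous_at_prod (I : Type) (r : seq I) (F : I -> T -> R) :
  (forall i, {for x, continuous (F i)}) ->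
  {for x, continuous (fun y => \prod_(i <- r) F i y)}.
Proof.
move=> Fc; elim: r => [|a r IH].
  rewrite /prop_for; under eq_fun do rewrite big_nil; exact: cst_continuous.
rewrite /prop_for; under eq_fun do rewrite big_cons.
by apply: continuousM; [exact: Fc|exact: IH].
Qed.

Lemma continuous_at_det p (F : T -> 'M[R]_p) :
  (forall i j, {for x, continuous (fun y => F y i j)}) ->
  {for x, continuous (fun y => \det (F y))}.
Proof.
move=> Fc; apply: continuous_at_sum => s _; apply: continuousM.
  exact: cst_continuous.
by apply: continuous_at_prod => i; exact: Fc.
Qed.

(** [invmx] is defined by cases, but the determinant stays nonzero near [x], where the entries are
    given by Cramer's formula. *)
Lemma continuous_at_invmx p (F : T -> 'M[R]_p) i j :
  (forall i j, {for x, continuous (fun y => F y i j)}) -> F x \in unitmx ->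
  {for x, continuous (fun y => invmx (F y) i j)}.
Proof.
move=> Fc Fu; have dc := continuous_at_det Fc.
have d0 : \det (F x) != 0 by move: Fu; rewrite unitmxE unitfE.
have dn : \forall y \near x, \det (F y) != 0.
  exact: cvgr_neq0 _ dc d0.
have cofc : {for x, continuous (fun y => (\det (F y))^-1 * cofactor (F y) j i)}.
  apply: continuousM; first exact: continuousV.
  apply: continuousM; first exact: cst_continuous.
  by apply: continuous_at_det => k l; rewrite /prop_for; under eq_fun do rewrite !mxE; exact: Fc.
have eqn : {near x, (fun y => (\det (F y))^-1 * cofactor (F y) j i) =1
    (fun y => invmx (F y) i j)}.
  by apply: filterS dn => y dy; rewrite /invmx unitmxE unitfE dy !mxE.
rewrite /prop_for /continuous_at -(nbhs_singleton eqn).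
exact: cvg_trans (near_eq_cvg eqn) cofc.
Qed.

Lemma continuous_at_chr m (G : T -> 'M[R]_m.+1) (dG : T -> 'I_m.+1 -> 'M[R]_m.+1) a b :
  (forall i j, {for x, continuous (fun y => G y i j)}) ->
  (forall k i j, {for x, continuous (fun y => dG y k i j)}) ->
  G x \in unitmx -> {for x, continuous (fun y => chr (G y) (dG y) a b)}.
Proof.
move=> Gc dGc Gu; apply: continuous_at_sum => l _; apply: continuousM.
  exact: continuous_at_invmx.
by apply: continuousB; [apply: continuousD|]; exact: dGc.
Qed.

Lemma continuous_at_jet_curv m (G : T -> 'M[R]_m.+1) (dG : T -> 'I_m.+1 -> 'M[R]_m.+1) :
  (forall i j, {for x, continuous (fun y => G y i j)}) ->
  (forall k i j, {for x, continuous (fun y => dG y k i j)}) ->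
  G x \in unitmx -> tangential (G x) \in unitmx ->
  {for x, continuous (fun y => jet_curv (G y) (dG y))}.
Proof.
move=> Gc dGc Gu tu; apply: continuous_at_sum => a _.
rewrite /prop_for; under eq_fun do rewrite mxE.
apply: continuous_at_sum => b _; apply: continuousM.
  apply: continuous_at_invmx => // i j; rewrite /prop_for; under eq_fun do rewrite mxE; exact: Gc.
rewrite /prop_for; under eq_fun do rewrite mxE; exact: continuous_at_chr.
Qed.

End ContinuousMatrices.

(** * Charts and changes of charts *)

Section OneSided.
Context {R : realType} {m : nat}.
Local Notation E := 'rV[R]_m.+1.

Lemma line_cvg (x v : E) : (fun t : R => t *: v + x) @ (0 : R) --> x.
Proof.
rewrite -[X in _ --> X](add0r x) -(scale0r v).
by apply: cvgD; [apply: cvgZr_tmp; exact: cvg_id|exact: cvg_cst].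
Qed.

Lemma line_cvg_right (x v : E) : (fun t : R => t *: v + x) @ (0 : R)^'+ --> x.
Proof.
by move=> A nA; apply: at_right0_dnbhs; apply: nbhs_dnbhs; exact: line_cvg nA.
Qed.

Lemma derive_cvg_right (F : E -> R^o) x v : differentiable F x ->
  (fun t : R => t^-1 *: (F (t *: v + x) - F x)) @ (0 : R)^'+ --> 'D_v F x.
Proof.
move=> dF; apply: cvg_trans (diff_derivable dF); apply: cvg_app.
exact: at_right0_dnbhs.
Qed.

(** For a differentiable function the limit over t > 0 is already the full derivative. This suits
    extensions, whose values are known only on the half-space. *)
Lemma derive_ge0 (F : E -> R^o) x v : differentiable F x ->
  (\forall t \near (0 : R)^'+, F x <= F (t *: v + x)) -> 0 <= 'D_v F x.
Proof.
move=> /derive_cvg_right cF Fx.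
apply: (cvgr_to_ge (cF v)).
near=> t; have t0 : 0 < t by near: t; exact: nbhs_right_gt.
apply: mulr_ge0; first by rewrite invr_ge0 ltW.
by rewrite subr_ge0; near: t.
Unshelve. all: by end_near. Qed.

Lemma derive_le (F1 F2 : E -> R^o) x v : differentiable F1 x -> differentiable F2 x ->
  F1 x = F2 x ->
  (\forall t \near (0 : R)^'+, F1 (t *: v + x) <= F2 (t *: v + x)) ->
  'D_v F1 x <= 'D_v F2 x.
Proof.
move=> d1 d2 F12 le12; rewrite -subr_ge0 -deriveB; [|exact: diff_derivable..].
apply: derive_ge0; first exact: differentiableB.
by apply: filterS le12 => t; rewrite !fctE F12 subrr subr_ge0.
Qed.

Lemma derive_eq0 (F : E -> R^o) x v : differentiable F x ->
  (\forall t \near (0 : R)^'+, F (t *: v + x) = F x) -> 'D_v F x = 0.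
Proof.
move=> dF Fx; apply/eqP; rewrite -(derive_cst (F x) x v) eq_le.
rewrite !derive_le//; try exact: differentiable_cst.
  by apply: filterS Fx => t ->.
by apply: filterS Fx => t ->.
Qed.

Lemma derive_min (F : E -> R^o) x v : differentiable F x ->
  (\forall t \near (0 : R), F x <= F (t *: v + x)) -> 'D_v F x = 0.
Proof.
move=> dF Fx.
have pos : 0 <= 'D_v F x.
  by apply: derive_ge0 => //; apply: (at_right0_dnbhs); exact: nbhs_dnbhs.
have neg : 0 <= 'D_(- v) F x.
  apply: derive_ge0 => //; apply: (at_right0_dnbhs); apply: nbhs_dnbhs.
  have /nbhs_ballP[e e0 eF] := Fx; apply/nbhs_ballP; exists e => // t te.
  rewrite scalerN -scaleNr; apply: eF; move: te.
  by rewrite -ball_normE /= !sub0r !normrN.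
apply/eqP; rewrite eq_le pos andbT -oppr_ge0.
by move: neg; rewrite !deriveE// linearN.
Qed.

End OneSided.

Section Charts.
Context {R : realType} {m : nat}.
Local Notation E := 'rV[R]_m.+1.

Lemma unitmx_col p (J : 'M[R]_p) k : J \in unitmx -> (forall i, J i k = 0) -> False.
Proof.
move=> Ju J0; have : J *m delta_mx k ord0 = 0 :> 'cV_p.
  by rewrite -colE; apply/colP => i; rewrite mxE J0 mxE.
move=> /(congr1 (mulmx (invmx J))); rewrite mulKmx// mulmx0.
by move=> /colP/(_ k); rewrite !mxE !eqxx => /eqP; rewrite oner_eq0.
Qed.

Lemma open_nbhs_ex (T : topologicalType) (x : T) (A : set T) : nbhs x A ->
  exists U, [/\ open U, U x & U `<=` A].
Proof. by rewrite nbhsE => -[U [oU Ux] UA]; exists U. Qed.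

Section Chart.
Context {T : topologicalType} (c : chart R m T).

Lemma chart_imageP x : chart_image c x ->
  chart_dom c (chart_inv c x) /\ chart_map c (chart_inv c x) = x.
Proof. by move=> [p cp <-]; rewrite (chart_mapK (mem_set cp)). Qed.

Lemma chart_image_map p : chart_dom c p -> chart_image c (chart_map c p).
Proof. by exists p. Qed.

Lemma chart_image_half x : chart_image c x -> half_space x.
Proof.
by have [U _ UH] := chart_image_open c; rewrite /chart_image UH => -[].
Qed.

(** The chart image is relatively open in the half-space and the inverse chart is continuous on it,
    so a neighbourhood in the manifold can be replaced by an open set of coordinates cut by the
    half-space. *)
Lemma chart_nbhs x (A : set T) : chart_image c x -> nbhs (chart_inv c x) A ->
  exists U : set E, [/\ open U, U x &
    forall y, U y -> half_space y -> chart_image c y /\ A (chart_inv c y)].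
Proof.
move=> cx nA; have [V oV VH] := chart_image_open c.
have := (subspace_continuousP _ _).1 (@chart_inv_continuous _ _ _ c) _ cx _ nA.
move=> nW; have : \forall y \near x, chart_image c y -> A (chart_inv c y) by exact: nW.
move=> /open_nbhs_ex[W [oW Wx WA]].
exists (V `&` W); split; first exact: openI.
  by split=> //; have [] : (V `&` half_space) x by rewrite -VH.
move=> y [Vy Wy] Hy; have cy : chart_image c y by rewrite /chart_image VH.
by split=> //; exact: WA.
Qed.

Lemma chart_map_nbhs p (A : set E) : chart_dom c p -> nbhs (chart_map c p) A ->
  \forall q \near p, A (chart_map c q).
Proof.
move=> cp nA.
have nW := (subspace_continuousP _ _).1 (@chart_map_continuous _ _ _ c) _ cp _ nA.
have nW' : \forall q \near p, chart_dom c q -> A (chart_map c q) by exact: nW.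
have nD : nbhs p (chart_dom c) by apply: open_nbhs_nbhs; split=> //; exact: chart_dom_open.
by apply: filterS2 nW' nD => q; apply.
Qed.

End Chart.

Variables (M : manifold R m) (g : riemannian_metric M).

Lemma metric_posdef (c : chart R m M) x : atlas c -> chart_image c x ->
  posdef (components g c x).
Proof. by move=> ac cx v v0; exact: metric_pos. Qed.

Lemma transition_extension (c d : chart R m M) p : atlas c -> atlas d ->
  chart_dom c p -> chart_dom d p ->
  exists (U : set E) (Phi : E -> E),
    [/\ open U, U (chart_map c p), forall k, Ck k U Phi &
     forall y, U y -> half_space y ->
       [/\ chart_image c y, chart_dom d (chart_inv c y) & Phi y = transition c d y]].
Proof.
move=> ac ad cp dp.
have cpi : (chart_map c @` (chart_dom c `&` chart_dom d)) (chart_map c p) by exists p.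
have [U1 [Phi [oU1 U1x PhiC PhiE]]] := atlas_compatible ac ad cpi.
have pK : chart_inv c (chart_map c p) = p by exact/(chart_mapK (mem_set cp)).
have [|U2 [oU2 U2x hU2]] := @chart_nbhs _ c (chart_map c p) (chart_dom d) (chart_image_map cp).
  by rewrite pK; apply: open_nbhs_nbhs; split=> //; exact: chart_dom_open.
exists (U1 `&` U2), Phi; split=> //; first exact: openI.
  by move=> k; apply: Ck_subset (PhiC k) => y [].
move=> y [U1y U2y] Hy; have [cy dy] := hU2 y U2y Hy; split=> //.
apply: PhiE; split=> //; have [ciy cK] := chart_imageP cy.
by exists (chart_inv c y).
Qed.

Lemma metric_extension (c : chart R m M) x : atlas c -> chart_image c x ->
  exists (U : set E) (F : E -> 'M[R]_m.+1),
    [/\ open U, U x, forall k, Ck k U F &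
     forall y, U y -> half_space y -> chart_image c y /\ F y = components g c y].
Proof.
move=> ac cx; have [U1 [F [oU1 U1x FC FE]]] := metric_smooth g ac cx.
have [|U2 [oU2 U2x hU2]] := @chart_nbhs _ c x setT cx.
  exact: filterT.
exists (U1 `&` U2), F; split=> //; first exact: openI.
  by move=> k; apply: Ck_subset (FC k) => y [].
move=> y [U1y U2y] Hy; have [cy _] := hU2 y U2y Hy; split=> //.
exact: FE.
Qed.

Section ChangeOfCharts.
Variables (c d : chart R m M) (p : M).
Hypotheses (ac : atlas c) (ad : atlas d) (cp : chart_dom c p) (dp : chart_dom d p).

Let x := chart_map c p.
Let y := chart_map d p.
Let xH : half_space x := chart_image_half (chart_image_map cp).

Lemma transition_jacobianE U Phi : open U -> U x -> Ck 1 U Phi ->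
  (forall z, U z -> half_space z -> Phi z = transition c d z) ->
  forall z, U z -> half_space z ->
  transition_jacobian c d z = \matrix_(i, a) 'D_(coord_vec i) (fun z => Phi z ord0 a : R^o) z.
Proof.
move=> oU Ux PhiC PhiE z Uz zH; apply/matrixP => i a; rewrite !mxE.
have [dP _] := @Ck_coord _ _ 1 U _ _ Phi ord0 a oU PhiC.
by apply: (partialE i oU Uz zH) (dP z Uz) => w Uw wH; rewrite PhiE.
Qed.

(** Read off from the metric: J G_d J^T equals the invertible matrix G_c, so the inverse transition
    need not be differentiated. *)
Lemma transition_jacobian_unit : transition_jacobian c d x \in unitmx.
Proof.
have Gu : components g c x \in unitmx.
  exact: posdef_unit (metric_posdef ac (chart_image_map cp)).
by move: Gu; rewrite (metric_transform g ac ad cp dp) !unitmx_mul => /andP[/andP[]].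
Qed.

End ChangeOfCharts.

(* Otherwise the normal coordinate of d would have an interior minimum in the
   chart c, so the Jacobian would have a zero column. *)
Lemma boundary_coord (c d : chart R m M) p : atlas c -> atlas d ->
  chart_dom c p -> chart_dom d p ->
  chart_map d p ord0 ord0 = 0 -> chart_map c p ord0 ord0 = 0.
Proof.
move=> ac ad cp dp d0; apply/eqP/negPn/negP => c0.
have xH := chart_image_half (chart_image_map cp).
have [U [Phi [oU Ux PhiC PhiE]]] := transition_extension ac ad cp dp.
set x := chart_map c p in c0 xH Ux.
have x0 : 0 < x ord0 ord0 by rewrite lt_def c0; exact: xH.
have PhiE' z : U z -> half_space z -> Phi z = transition c d z.
  by move=> Uz zH; have [] := PhiE z Uz zH.
have JE := transition_jacobianE oU Ux (PhiC 1) PhiE' Ux xH.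
have := transition_jacobian_unit ac ad cp dp; rewrite -/x JE.
set J := \matrix_(i, a) _; move=> Ju.
have [dP _] := @Ck_coord _ _ 1 U _ _ Phi ord0 ord0 oU (PhiC 1).
have Phix : Phi x ord0 ord0 = 0.
  by rewrite PhiE'// /transition (chart_mapK (mem_set cp)).
have near_in : \forall z \near x, U z /\ 0 < z ord0 ord0.
  apply: filterI; first exact: open_nbhs_nbhs.
  exact: (cvgr_gt _ (@coord_continuous _ _ _ ord0 ord0 x) _ x0).
have Phi_ge : \forall z \near x, 0 <= Phi z ord0 ord0.
  apply: filterS near_in => z [Uz z0]; have zH : half_space z by exact: ltW.
  have [cz dz ->] := PhiE z Uz zH.
  exact: (chart_image_half (chart_image_map dz)).
have J0 i : J i ord0 = 0.
  rewrite mxE; apply: derive_min (dP x Ux) _; rewrite Phix.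
  exact: line_cvg Phi_ge.
exact: unitmx_col Ju J0.
Qed.

Lemma boundaryP (c : chart R m M) p : atlas c -> chart_dom c p ->
  boundary p <-> chart_map c p ord0 ord0 = 0.
Proof.
move=> ac cp; split; last by exists c.
by move=> [d [ad dp d0]]; exact: boundary_coord d0.
Qed.

End Charts.

(** * The derivative of a pulled-back metric *)

Section PullbackJet.
Context {R : realType} {m : nat}.
Local Notation E := 'rV[R]_m.+1.

Lemma mulmx3E p (J B L : 'M[R]_p) k l :
  (J *m B *m L^T) k l = \sum_b \sum_a J k a * B a b * L l b.
Proof.
by rewrite mxE; apply: eq_bigr => b _; rewrite !mxE mulr_suml.
Qed.

Lemma product_rule3 (r s t dr ds dt : R) :
  (r * s) *: (dt : R^o) + t *: (r *: (ds : R^o) + s *: (dr : R^o)) =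
  dr * s * t + r * ds * t + r * s * dt.
Proof. by rewrite /GRing.scale /=; ring. Qed.

Definition jacobian_mx (Phi : E -> E) (z : E) : 'M[R]_m.+1 :=
  \matrix_(i, a) 'D_(coord_vec i) (fun z => Phi z ord0 a : R^o) z.

Definition hessian_mx (Phi : E -> E) (z : E) i : 'M[R]_m.+1 :=
  \matrix_(j, a) 'D_(coord_vec i) ('D_(coord_vec j) (fun z => Phi z ord0 a : R^o)) z.

Lemma hessian_mx_sym (U : set E) (Phi : E -> E) z i j k : open U -> U z -> Ck 2 U Phi ->
  hessian_mx Phi z i j k = hessian_mx Phi z j i k.
Proof.
move=> oU Uz PhiC; have S := schwarz i j oU Uz (Ck_coord ord0 k oU PhiC).
by rewrite [LHS]mxE [RHS]mxE; exact: S.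
Qed.

(** Each entry is a double sum of triple products, two Jacobian entries around one entry of
    [F \o Phi]; regrouping the product rule gives the shape of hypothesis [dGcE] above. *)
Lemma is_derive_pullback (U V : set E) (Phi : E -> E) (F : E -> 'M[R]_m.+1) x i k l :
  open U -> open V -> U x -> (forall z, U z -> V (Phi z)) -> Ck 2 U Phi -> Ck 1 V F ->
  let f := fun z => (jacobian_mx Phi z *m F (Phi z) *m (jacobian_mx Phi z)^T) k l : R^o in
  differentiable f x /\
  'D_(coord_vec i) f x =
   (hessian_mx Phi x i *m F (Phi x) *m (jacobian_mx Phi x)^T
   + jacobian_mx Phi x *m (\sum_q jacobian_mx Phi x i q *: 'D_(coord_vec q) F (Phi x)) *m (jacobian_mx Phi x)^T
   + jacobian_mx Phi x *m F (Phi x) *m (hessian_mx Phi x i)^T) k l.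
Proof.
move=> oU oV Ux UV PhiC FC f.
have dJ j a : differentiable ('D_(coord_vec j) (fun z => Phi z ord0 a : R^o)) x.
  have [_ /(_ j)[d _]] := @Ck_coord _ _ 2 U _ _ Phi ord0 a oU PhiC.
  exact: d.
have dPhi : differentiable Phi x by have [d _] := PhiC; exact: d.
have dF : differentiable F (Phi x) by have [d _] := FC; apply: d; exact: UV.
have Fab a b (y : E) : differentiable F y -> differentiable (fun y => F y a b : R^o) y.
  move=> dFy; exact: (@differentiable_comp _ _ _ _ F (fun N : 'M[R]_m.+1 => N a b : R^o) y dFy
            (differentiable_coord _ _ _)).
have dB a b : differentiable (fun z => F (Phi z) a b : R^o) x.
  exact: (@differentiable_comp _ _ _ _ Phi (fun y => F y a b : R^o) x dPhi (Fab a b _ dF)).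
have DB a b : 'D_(coord_vec i) (fun z => F (Phi z) a b : R^o) x =
    (\sum_q jacobian_mx Phi x i q *: 'D_(coord_vec q) F (Phi x)) a b.
  have [_ ->] := derive_comp_rV (coord_vec i) dPhi (Fab a b _ dF).
  rewrite summxE; apply: eq_bigr => q _; rewrite !mxE.
  rewrite derive_mx; last exact: diff_derivable.
  by rewrite mxE.
pose J j a := 'D_(coord_vec j) (fun z => Phi z ord0 a : R^o).
pose B a b : E -> R^o := fun z => F (Phi z) a b.
have fE : f = \sum_(b < m.+1) \sum_(a < m.+1) (J k a * B a b * J l b).
  apply/funext => z; rewrite /f mulmx3E fct_sumE; apply: eq_bigr => b _.
  rewrite fct_sumE; apply: eq_bigr => a _.
  by rewrite !mxE.
have dd : is_derive x (coord_vec i) f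
  (\sum_(b < m.+1) \sum_(a < m.+1)
    ((J k a * B a b) x *: 'D_(coord_vec i) (J l b) x +
     J l b x *: (J k a x *: 'D_(coord_vec i) (B a b) x + B a b x *: 'D_(coord_vec i) (J k a) x))).
  rewrite fE; apply: is_derive_sum => b; apply: is_derive_sum => a.
  apply: is_deriveM; last exact/derivableP/diff_derivable/dJ.
  apply: is_deriveM; first exact/derivableP/diff_derivable/dJ.
  exact/derivableP/diff_derivable/dB.
split.
  rewrite fE; apply: differentiable_sum => b; apply: differentiable_sum => a.
  apply: differentiableM; last exact: dJ.
  by apply: differentiableM; [exact: dJ|exact: dB].
rewrite (@derive_val _ _ _ _ _ _ _ dd) [RHS]mxE [X in _ = X + _]mxE !mulmx3E.
rewrite -!big_split; apply: eq_bigr => b _ /=.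
rewrite -!big_split; apply: eq_bigr => a _ /=.
rewrite DB [jacobian_mx Phi x k a]mxE [jacobian_mx Phi x l b]mxE.
rewrite [hessian_mx _ _ _ _ _]mxE [hessian_mx _ _ _ l b]mxE.
exact: product_rule3.
Qed.

End PullbackJet.

(** * The sign of the curvature trace does not depend on the chart *)

Section ChartChange.
Context {R : realType} {m : nat}.
Local Notation E := 'rV[R]_m.+1.
Variables (M : manifold R m) (g : riemannian_metric M).

Definition chart_curv (c : chart R m M) (p : M) : R :=
  jet_curv (components g c (chart_map c p)) (metric_jet (components g c) (chart_map c p)).

Lemma chart_curv_change (c d : chart R m M) p : atlas c -> atlas d ->
  chart_dom c p -> chart_dom d p -> chart_map c p ord0 ord0 = 0 ->
  exists2 j, 0 < j & j * chart_curv c p = chart_curv d p.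
Proof.
move=> ac ad cp dp x0.
have y0 := boundary_coord g ad ac dp cp x0.
have xH := chart_image_half (chart_image_map cp).
have yH := chart_image_half (chart_image_map dp).
have [U1 [Phi [oU1 U1x PhiC1 PhiE1]]] := transition_extension ac ad cp dp.
have [V [F [oV Vy FC FE]]] := metric_extension g ad (chart_image_map dp).
rewrite /chart_curv; set x := chart_map c p in x0 xH U1x *.
set y := chart_map d p in y0 yH Vy *.
have Phix : Phi x = y.
  have [_ _ ->] := PhiE1 x U1x xH.
  by rewrite /transition (chart_mapK (mem_set cp)).
have [W [oW Wx WV]] : exists W, [/\ open W, W x & W `<=` Phi @^-1` V].
  apply: open_nbhs_ex; have Phic : {for x, continuous Phi} by exact: (PhiC1 0).
  by apply: Phic; rewrite Phix; exact: open_nbhs_nbhs.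
pose U := U1 `&` W.
have oU : open U by exact: openI.
have Ux : U x by [].
have UV z : U z -> V (Phi z) by move=> [_ /WV].
have PhiC k : Ck k U Phi by apply: Ck_subset (PhiC1 k) => z [].
have PhiE z : U z -> half_space z ->
    [/\ chart_image c z, chart_dom d (chart_inv c z) & Phi z = transition c d z].
  by move=> [U1z _]; exact: PhiE1.
have PhiE' z : U z -> half_space z -> Phi z = transition c d z.
  by move=> Uz zH; have [] := PhiE z Uz zH.
have JE z : U z -> half_space z -> transition_jacobian c d z = jacobian_mx Phi z.
  exact: (transition_jacobianE oU Ux (PhiC 1) PhiE').
have Phi_half z : U z -> half_space z -> half_space (Phi z).
  by move=> Uz zH; have [_ dz ->] := PhiE z Uz zH; exact: chart_image_half (chart_image_map dz).
(* The boundary face is mapped into the boundary face. One tangential derivative of this gives [J0]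
   along the whole face, and a second one gives [H0]. *)
have Phi_bd z : U z -> z ord0 ord0 = 0 -> Phi z ord0 ord0 = 0.
  move=> Uz z0; have zH : half_space z by rewrite /half_space /= z0.
  have [cz dz ->] := PhiE z Uz zH; have [ciz cK] := chart_imageP cz.
  by apply: (boundary_coord g ad ac dz ciz); rewrite cK.
(* A smooth extension of the components in [c], chosen as a pullback so that its derivative is
   explicit. *)
pose G z := jacobian_mx Phi z *m F (Phi z) *m (jacobian_mx Phi z)^T.
have GE z : U z -> half_space z -> G z = components g c z.
  move=> Uz zH; have [cz dz PhizE] := PhiE z Uz zH; have [ciz cK] := chart_imageP cz.
  have := metric_transform g ac ad ciz dz; rewrite cK JE// => ->.
  have [_ FzE] := FE _ (UV z Uz) (Phi_half z Uz zH).
  by rewrite /G FzE PhizE.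
have dP z j : U z -> differentiable ('D_(coord_vec j) (fun z => Phi z ord0 ord0 : R^o)) z.
  have [_ /(_ j)[d2 _]] := @Ck_coord _ _ 2 U _ _ Phi ord0 ord0 oU (PhiC 2).
  exact: d2.
have dP0 z : U z -> differentiable (fun z => Phi z ord0 ord0 : R^o) z.
  by have [d1 _] := @Ck_coord _ _ 1 U _ _ Phi ord0 ord0 oU (PhiC 1); exact: d1.
have nearU z (v : E) : U z -> \forall t \near (0 : R)^'+, U (t *: v + z).
  move=> Uz; have nU : nbhs z U by exact: open_nbhs_nbhs.
  exact: line_cvg_right nU.
have tang_bd (z : E) (t : R) (i : 'I_m.+1) : i != ord0 -> z ord0 ord0 = 0 -> (t *: coord_vec i + z) ord0 ord0 = 0 :> R.
  by move=> /negPf i0 z0; rewrite !mxE z0 eqxx /= eq_sym i0 mulr0 addr0.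
have J0 z i : U z -> z ord0 ord0 = 0 -> i != ord0 -> jacobian_mx Phi z i ord0 = 0.
  move=> Uz z0 i0; rewrite mxE; apply: derive_eq0 (dP0 z Uz) _.
  apply: filterS (nearU z (coord_vec i) Uz) => t Ut.
  by rewrite !Phi_bd// tang_bd.
have H0 i j : i != ord0 -> j != ord0 -> hessian_mx Phi x i j ord0 = 0.
  move=> i0 j0; rewrite mxE; apply: derive_eq0 (dP x j Ux) _.
  apply: filterS (nearU x (coord_vec i) Ux) => t Ut.
  have := J0 _ j Ut (tang_bd x t i i0 x0) j0; rewrite mxE => ->.
  by have := J0 x j Ux x0 j0; rewrite mxE => ->.
have Hs i j k : hessian_mx Phi x i j k = hessian_mx Phi x j i k.
  exact: hessian_mx_sym oU Ux (PhiC 2%N).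
have Gcp := metric_posdef g ac (chart_image_map cp).
have Gdp := metric_posdef g ad (chart_image_map dp).
have GcE : components g c x =
    jacobian_mx Phi x *m components g d y *m (jacobian_mx Phi x)^T.
  by rewrite -(JE x Ux xH); exact: metric_transform.
have dFy : differentiable F y by have [dF _] := FC 1%N; exact: dF.
have FEy z : V z -> half_space z -> F z = components g d z.
  by move=> Vz zH; have [] := FE z Vz zH.
have Fy : F y = components g d y by exact: FEy.
have jetd q : metric_jet (components g d) y q = 'D_(coord_vec q) F y.
  exact: metric_jetE oV Vy yH FEy dFy.
have jetc i : metric_jet (components g c) x i =
    hessian_mx Phi x i *m components g d y *m (jacobian_mx Phi x)^T
    + jacobian_mx Phi x *m (\sum_q jacobian_mx Phi x i q *: metric_jet (components g d) y q)
      *m (jacobian_mx Phi x)^T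
    + jacobian_mx Phi x *m components g d y *m (hessian_mx Phi x i)^T.
  under eq_bigr do rewrite jetd; rewrite -Fy -Phix.
  apply/matrixP => k l; rewrite mxE.
  have [dGkl <-] := is_derive_pullback i k l oU oV Ux UV (PhiC 2%N) (FC 1%N).
  apply: (partialE i oU Ux xH _ dGkl) => z Uz zH.
  by rewrite -(GE z Uz zH).
have Ju : jacobian_mx Phi x \in unitmx.
  by rewrite -(JE x Ux xH); exact: (transition_jacobian_unit g ac ad cp dp).
(* Nonnegative, because the normal coordinate of [d] cannot decrease from 0 along an inward ray;
   nonzero, because the rest of column 0 vanishes and the Jacobian is invertible. *)
exists (jacobian_mx Phi x ord0 ord0).
  rewrite lt_def; apply/andP; split.
    apply/eqP => J00; apply: (unitmx_col Ju (k := ord0)) => i.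
    have [->//|i0] := eqVneq i ord0; exact: J0.
  rewrite mxE; apply: derive_ge0; first exact: dP0.
  rewrite (Phi_bd x Ux x0).
  have tpos : \forall t \near (0 : R)^'+, 0 < t by exact: nbhs_right_gt.
  apply: filterS2 tpos (nearU x (coord_vec ord0) Ux) => t t0 Ut.
  apply: Phi_half => //; rewrite /half_space /= !mxE x0 addr0 eqxx mulr1.
  exact: ltW.
apply: (@jet_curv_transform _ _ _ _ _ _ _ (hessian_mx Phi x)) => //.
- exact: posdef_unit.
- exact: (Defs.metric_sym g ad (chart_image_map dp)).
- exact: posdef_unit.
- by move=> i i0; exact: J0.
- exact/posdef_unit/posdef_tangential.
Qed.

End ChartChange.

(** * The conformal factor *)

Section SmoothFunctions.
Context {R : realType} {m : nat}.
Local Notation E := 'rV[R]_m.+1.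
Variable M : manifold R m.

Lemma smooth_fun0 : smooth_fun (fun _ : M => 0 : R).
Proof.
move=> c _ x _; exists setT, (fun=> 0); split=> //; first exact: openT.
by move=> k; exact: Ck_cst.
Qed.

Lemma smooth_funD (u v : M -> R) : smooth_fun u -> smooth_fun v ->
  smooth_fun (fun p => u p + v p).
Proof.
move=> us vs c ac x cx.
have [U [F [oU Ux FC FE]]] := us c ac x cx.
have [V [G [oV Vx GC GE]]] := vs c ac x cx.
exists (U `&` V), (fun y => F y + G y); split=> //; first exact: openI.
  move=> k; apply: CkD; first exact: openI.
    by apply: Ck_subset (FC k) => y [].
  by apply: Ck_subset (GC k) => y [].
by move=> y [[Uy Vy] cy]; rewrite FE// GE.
Qed.

Lemma smooth_fun_sum (I : Type) (r : seq I) (u : I -> M -> R) :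
  (forall i, smooth_fun (u i)) -> smooth_fun (fun p => \sum_(i <- r) u i p).
Proof.
move=> us; elim: r => [|i r IH].
  rewrite [X in smooth_fun X](_ : _ = fun=> 0); first exact: smooth_fun0.
  by apply/funext => p; rewrite big_nil.
rewrite [X in smooth_fun X](_ : _ = fun p => u i p + \sum_(j <- r) u j p).
  exact: smooth_funD.
by apply/funext => p; rewrite big_cons.
Qed.

Lemma smooth_fun_comp1 (C : set (R -> R)) (h : R -> R) (u : M -> R) :
  (forall h, C h -> exists2 h', C h' & forall t : R, is_derive t 1 h (h' t)) ->
  C h -> smooth_fun u -> smooth_fun (h \o u).
Proof.
move=> hC Ch us c ac x cx; have [U [F [oU Ux FC FE]]] := us c ac x cx.
exists U, (h \o F); split=> //.
  by move=> k; exact: Ck_comp1 oU hC Ch (FC k).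
by move=> y Uy; rewrite /= FE.
Qed.

Lemma smooth_fun_expR (b : R) (u : M -> R) : smooth_fun u ->
  smooth_fun (fun p => expR (b * u p)).
Proof.
apply: (@smooth_fun_comp1 (range (fun a t => a * expR (b * t))) (fun t => expR (b * t))).
  move=> _ [a _ <-]; exists (fun t => (a * b) * expR (b * t)); first by exists (a * b).
  move=> t; have dl : is_derive t (1 : R) (fun t => b * t) b.
    by have := is_deriveZ b (is_derive_id t (1 : R)); rewrite [_ *: 1]mulr1.
  have de : is_derive t (1 : R) (expR \o (fun t => b * t)) (expR (b * t) * b).
    exact: is_derive1_comp.
  have := is_deriveZ a de; congr (is_derive _ _ _ _).
  by rewrite /GRing.scale /=; ring.
by exists 1 => //; apply/funext => t; rewrite mul1r.
Qed.

Definition chart_extend (c : chart R m M) (eta : E -> R) (p : M) : R :=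
  if `[< chart_dom c p >] then eta (chart_map c p) else 0.

Lemma chart_extendE c eta p : chart_dom c p -> chart_extend c eta p = eta (chart_map c p).
Proof. by move=> cp; rewrite /chart_extend asboolT. Qed.

(** Inside the domain of [c] the function is [eta] composed with a smooth transition. At a point
    outside, the image of [K] is compact, hence closed in a Hausdorff space, so the function is zero
    on a whole neighbourhood. *)
Lemma smooth_chart_extend (c : chart R m M) (eta : E -> R) (K : set E) : atlas c ->
  (forall k, Ck k setT (eta : E -> R^o)) -> compact K -> K `<=` chart_image c ->
  (forall y, chart_image c y -> ~ K y -> eta y = 0) ->
  smooth_fun (chart_extend c eta).
Proof.
move=> ac etaC cK Kc eta0 d ad y dy; have [dq dK] := chart_imageP dy.
set q := chart_inv d y in dq dK.
have [cq|ncq] := pselect (chart_dom c q).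
  have [U [Phi [oU Uy PhiC PhiE]]] := transition_extension ad ac dq cq.
  rewrite dK in Uy; exists U, (eta \o Phi); split=> //.
    by move=> k; apply: (Ck_comp oU openT _ (etaC k) (PhiC k)).
  move=> z [Uz dz]; have [_ cz PhizE] := PhiE z Uz (chart_image_half dz).
  by rewrite chart_extendE//= PhizE.
have clA : closed (chart_inv c @` K).
  apply: compact_closed; first exact: manifold_hausdorff.
  apply: continuous_compact => //.
  exact: continuous_subspaceW Kc (@chart_inv_continuous _ _ _ c).
have nA : nbhs q (~` (chart_inv c @` K)).
  apply: open_nbhs_nbhs; split; first exact: closed_openC.
  by move=> [z Kz zq]; apply: ncq; rewrite -zq; have [] := chart_imageP (Kc z Kz).
have [U [oU Uy hU]] := chart_nbhs dy nA.
exists U, (fun=> 0); split=> //; first by move=> k; exact: Ck_cst.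
move=> z [Uz dz]; have [_ nz] := hU z Uz (chart_image_half dz).
rewrite /chart_extend; case: asboolP => // cz; rewrite eta0//.
  exact: chart_image_map.
move=> Kz; apply: nz; exists (chart_map c (chart_inv d z)) => //.
exact: chart_mapK (mem_set cz).
Qed.

Lemma half_ball_compact (x : E) r : compact ([set y : E | `|x - y| <= r] `&` half_space).
Proof.
apply: bounded_closed_compact.
  exists (`|x| + r); split; first exact: num_real.
  move=> M' hM' y [/= xy _]; apply: le_trans (ltW hM').
  rewrite -[X in `|X|](subKr x) (le_trans (ler_normB _ _))//.
  by rewrite lerD2l.
apply: closedI.
  have -> : [set y : E | `|x - y| <= r] = (fun y => `|x - y|) @^-1` [set t | t <= r] by [].
  apply: preimage_closed; last exact: closed_le.
  move=> y _.
  apply: (@continuous_comp _ _ _ (fun y : E => x - y) (fun z : E => `|z|)).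
    by apply: continuousB; [exact: cst_continuous|exact: cvg_id].
  exact: norm_continuous.
have -> : @half_space R m = (fun y => y ord0 ord0) @^-1` [set t | 0 <= t] by [].
apply: preimage_closed; last exact: closed_ge.
by move=> y _; exact: coord_continuous.
Qed.

End SmoothFunctions.

(** * A weight that beats the curvature near one point *)

Section LocalWeight.
Context {R : realType} {m : nat}.
Local Notation E := 'rV[R]_m.+1.
Variables (M : manifold R m) (g : riemannian_metric M).

Lemma continuous_entries (U : set E) (F : E -> 'M[R]_m.+1) x : U x -> Ck 0 U F ->
  forall i j, {for x, continuous (fun y => F y i j)}.
Proof.
move=> Ux Fc i j.
exact: (continuous_comp (Fc x Ux) (@coord_continuous R m.+1 m.+1 i j (F x))).
Qed.

Lemma chart_curvE (c : chart R m M) p (U : set E) (F : E -> 'M[R]_m.+1) :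
  chart_dom c p -> open U -> U (chart_map c p) -> Ck 1 U F ->
  (forall y, U y -> half_space y -> F y = components g c y) ->
  chart_curv g c p =
  jet_curv (F (chart_map c p)) (fun i => 'D_(coord_vec i) F (chart_map c p)).
Proof.
move=> cp oU Ux [dF _] FE; have xH := chart_image_half (chart_image_map cp).
rewrite /chart_curv -FE//; congr jet_curv; apply/funext => i.
exact: metric_jetE oU Ux xH FE (dF _ Ux).
Qed.

Lemma local_weight (q : M) : (0 < m)%N -> exists (c : chart R m M) (b : E -> R),
  [/\ atlas c, forall y, 0 <= b y, forall k, Ck k setT (b : E -> R^o),
    smooth_fun (chart_extend c (fun y => y ord0 ord0 * b y)) &
    \forall p \near q, chart_dom c p /\
      chart_curv g c p <
      m%:R * (invmx (components g c (chart_map c p)) ord0 ord0 * b (chart_map c p))].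
Proof.
move=> m0; have [c ac cq] := atlas_cover q.
have cx := chart_image_map cq.
have [U [F [oU Ux FC FE]]] := metric_extension g ac cx.
set x := chart_map c q in cx Ux *.
have FE' y : U y -> half_space y -> F y = components g c y.
  by move=> Uy yH; have [] := FE y Uy yH.
have [r r0 rU] : exists2 r : R, 0 < r & ball x r `<=` U.
  by have /nbhs_ballP[r r0 rU] : nbhs x U by [exact: open_nbhs_nbhs]; exists r.
have r20 : 0 < r / 2 by rewrite divr_gt0.
have xH := chart_image_half cx.
have Fp : posdef (F x) by rewrite FE'//; exact: metric_posdef.
have Fs : (F x)^T = F x by rewrite FE'//; exact: (Defs.metric_sym g ac cx).
pose j y := jet_curv (F y) (fun i => 'D_(coord_vec i) F y).
pose v y := invmx (F y) ord0 ord0.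
have v0 : 0 < v x by exact: posdef_inv_diag.
have be0 : 0 < smooth_bump x (r / 2) x by exact: smooth_bump_center.
have mR : (0 : R) < m%:R by rewrite ltr0n.
(* Normalised so that at [x] the term m * v * b equals |j x| + 1, which exceeds j x; continuity of
   [psi] then spreads the strict inequality to a neighbourhood. *)
pose C := (`|j x| + 1) / (m%:R * (v x * smooth_bump x (r / 2) x)).
have C0 : 0 <= C.
  apply: divr_ge0; first exact: addr_ge0 (normr_ge0 _) ler01.
  exact: mulr_ge0 (ltW mR) (mulr_ge0 (ltW v0) (ltW be0)).
pose b y := C * smooth_bump x (r / 2) y.
have bC k : Ck k setT (b : E -> R^o).
  exact: Ck_scale openT (Ck_cst _ _ (C : R^o)) (Ck_smooth_bump k x (r / 2)).
exists c, b; split=> //.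
- by move=> y; rewrite mulr_ge0// smooth_bump_ge0.
(* The bump has radius r/2, so the closed half-ball containing its support within the half-space
   still lies in the ball of radius r, hence in the chart image. *)
- apply: (smooth_chart_extend ac _ (@half_ball_compact R m x (r / 2))).
  + by move=> k; exact: Ck_scale openT (Ck_coordinate k ord0) (bC k).
  + move=> y [/= xy yH]; have [] := FE y _ yH => //; apply: rU.
    rewrite -ball_normE /= (le_lt_trans xy)//.
    by rewrite ltr_pdivrMr// ltr_pMr// ltr1n.
  + move=> y cy nK; rewrite /b smooth_bump_out ?mulr0//.
    rewrite leNgt; apply/negP => xy; apply: nK; split; first exact: ltW.
    exact: chart_image_half cy.
have vc : {for x, continuous v}.
  apply: continuous_at_invmx; last exact: posdef_unit.
  exact: (continuous_entries Ux (FC 0%N)).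
have jc : {for x, continuous j}.
  apply: (@continuous_at_jet_curv R _ x m F (fun y i => 'D_(coord_vec i) F y)).
  - exact: (continuous_entries Ux (FC 0%N)).
  - move=> k; have [_ DF] := FC 1%N.
    exact: (@continuous_entries U (fun y => 'D_(coord_vec k) F y) x Ux (DF k)).
  - exact: posdef_unit.
  - exact/posdef_unit/posdef_tangential.
have bc : {for x, continuous b} by exact: (bC 0%N).
pose psi y := m%:R * (v y * b y) - j y.
have psic : {for x, continuous psi}.
  apply: continuousB => //; apply: continuousM; first exact: cst_continuous.
  exact: continuousM.
have psi0 : 0 < psi x.
  have -> : psi x = `|j x| + 1 - j x.
    rewrite /psi /b /C; congr (_ - _); field.
    by rewrite !gt_eqF.
  by rewrite subr_gt0 (le_lt_trans (ler_norm _))// ltrDl.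
have npsi : \forall y \near x, U y /\ 0 < psi y.
  apply: filterI; first exact: open_nbhs_nbhs.
  exact: cvgr_gt _ psic _ psi0.
have nD : nbhs q (chart_dom c) by apply: open_nbhs_nbhs; split=> //; exact: chart_dom_open.
apply: filterS2 nD (chart_map_nbhs cq npsi) => p cp [Up psip]; split=> //.
have pH := chart_image_half (chart_image_map cp).
rewrite (chart_curvE cp oU Up (FC 1%N) FE') -subr_gt0 -FE'//.
Qed.

End LocalWeight.

(** * Compactness and the conformal metric *)

Section Main.
Context {R : realType} {m : nat}.
Local Notation E := 'rV[R]_m.+1.

(** Compactness is used as a near-covering property, for the filter on finite sequences generated by
    the upper sets for inclusion: enlarging a sequence keeps every point already covered. *)
Lemma compact_finite_cover (T : topologicalType) (K : set T) (W : T -> set T) :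
  compact K -> (forall x, K x -> nbhs x (W x)) ->
  exists s : seq T, forall y, K y -> exists2 x, x \in s & W x y.
Proof.
move=> /compact_near_coveringP cK WK.
pose F : set_system (seq T) := filter_from [set: seq T] (fun s => [set t : seq T | {subset s <= t}]).
have FF : Filter F.
  apply: filter_from_filter; first by exists [::].
  move=> s t _ _; exists (s ++ t) => //= u /= su.
  by split=> z zs; apply: su; rewrite mem_cat zs ?orbT.
have [|s _ sP] := cK _ F (fun s y => exists2 x, x \in s & W x y) FF.
  move=> x Kx; exists (W x, [set t : seq T | {subset [:: x] <= t}]).
    by split; [exact: WK|exists [:: x]].
  move=> [y t] [/= Wy xt]; exists x => //.
  by apply: xt; rewrite inE.
by exists s => y Ky; apply: (sP s).
Qed.

Variables (M : manifold R m) (g : riemannian_metric M).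

(** The difference is 4 / (m - 1). Its being nonzero lets any positive smooth factor be written as a
    power u^(p-2). *)
Lemma conformal_exponent_neq2 : (1 < m)%N -> conformal_exponent R m - 2 != 0.
Proof.
move=> m1; have m10 : (m%:R - 1 : R) != 0 by rewrite subr_eq0 (eqr_nat R m 1) gtn_eqF.
have e : (m.+1%:R - 2 : R) = m%:R - 1 by rewrite -natr1; ring.
have -> : conformal_exponent R m - 2 = 4 / (m%:R - 1).
  by rewrite /conformal_exponent e -natr1; field.
by rewrite mulf_neq0 ?invr_eq0// pnatr_eq0.
Qed.

Lemma conformal_metric_exists (f : M -> R) : (1 < m)%N -> smooth_fun f ->
  exists gt : riemannian_metric M, conformal g gt /\
    forall c x, components gt c x = expR (f (chart_inv c x)) *: components g c x.
Proof.
move=> m1 fs; pose G (c : chart R m M) x := expR (f (chart_inv c x)) *: components g c x.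
have Gsym c x : atlas c -> chart_image c x -> (G c x)^T = G c x.
  by move=> ac cx; rewrite /G linearZ /= (Defs.metric_sym g ac cx).
have Gpos c x (v : E) : atlas c -> chart_image c x -> v != 0 ->
    0 < (v *m G c x *m v^T) ord0 ord0.
  move=> ac cx v0; rewrite /G -scalemxAr -scalemxAl mxE.
  by rewrite mulr_gt0 ?expR_gt0//; exact: (metric_pos g ac cx v0).
have Gsmooth c : atlas c -> smooth_on (chart_image c) (G c).
  move=> ac x cx; have [U [L [oU Ux LC LE]]] := smooth_fun_expR 1 fs ac cx.
  have [V [F [oV Vx FC FE]]] := metric_extension g ac cx.
  exists (U `&` V), (fun y => L y *: F y); split=> //; first exact: openI.
    move=> k; apply: Ck_scale; first exact: openI.
      by apply: Ck_subset (LC k) => y [].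
    by apply: Ck_subset (FC k) => y [].
  move=> y [[Uy Vy] cy]; have [_ ->] := FE y Vy (chart_image_half cy).
  by rewrite LE// mul1r.
have Gtransform c d p : atlas c -> atlas d -> chart_dom c p -> chart_dom d p ->
    let J := transition_jacobian c d (chart_map c p) in
    G c (chart_map c p) = J *m G d (chart_map d p) *m J^T.
  move=> ac ad cp dp /=; rewrite /G (chart_mapK (mem_set cp)) (chart_mapK (mem_set dp)).
  by rewrite -scalemxAr -scalemxAl -(metric_transform g ac ad cp dp).
exists (RiemannianMetric Gsym Gpos Gsmooth Gtransform); split=> //.
pose e := conformal_exponent R m - 2.
exists (fun p => expR (e^-1 * f p)); split.
- exact: smooth_fun_expR.
- by move=> p; exact: expR_gt0.
- move=> c p ac cp /=; rewrite /G (chart_mapK (mem_set cp)); congr (_ *: _).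
  by rewrite -expRM -/e mulrAC mulVf ?conformal_exponent_neq2// mul1r.
Qed.

(** An inequality suffices: f lies above x_0 * b and both vanish on the boundary, so the normal
    derivative of the factor is at least b, and the curvature drops by at least the corresponding
    amount. *)
Lemma chart_curv_conformal (gt : riemannian_metric M) (f : M -> R) (b : E -> R)
    (c : chart R m M) p :
  smooth_fun f -> atlas c -> chart_dom c p -> boundary p ->
  (forall x, components gt c x = expR (f (chart_inv c x)) *: components g c x) ->
  (forall q, boundary q -> f q = 0) ->
  Ck 1 setT (b : E -> R^o) ->
  (forall q, chart_dom c q -> chart_map c q ord0 ord0 * b (chart_map c q) <= f q) ->
  chart_curv gt c p <= chart_curv g c p
    - m%:R * (invmx (components g c (chart_map c p)) ord0 ord0 * b (chart_map c p)).
Proof.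
move=> fs ac cp bp gtE f0 bC bf; have cx := chart_image_map cp.
have x0 := (boundaryP g ac cp).1 bp.
have xH := chart_image_half cx.
have [U0 [L [oU0 U0x LC LE]]] := smooth_fun_expR 1 fs ac cx.
have [V [F [oV Vx FC FE]]] := metric_extension g ac cx.
have pK := chart_mapK (mem_set cp).
set x := chart_map c p in cx x0 xH U0x Vx pK *.
pose U := U0 `&` V; have oU : open U by exact: openI.
have Ux : U x by [].
have LE' y : U y -> half_space y -> chart_image c y /\ L y = expR (f (chart_inv c y)).
  move=> [U0y Vy] yH; have [cy _] := FE y Vy yH; split=> //.
  by rewrite LE// mul1r.
have FE' y : U y -> half_space y -> F y = components g c y.
  by move=> [_ Vy] yH; have [] := FE y Vy yH.
have Lx : L x = 1.
  by have [_ ->] := LE' x Ux xH; rewrite pK f0// expR0.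
have CF : Ck 1 U F by apply: Ck_subset (FC 1%N) => y [].
have CL : Ck 1 U L by apply: Ck_subset (LC 1%N) => y [].
have dF : differentiable F x by have [d _] := CF; exact: d.
have dL : differentiable L x by have [d _] := CL; exact: d.
have KE y : U y -> half_space y -> L y *: F y = components gt c y.
  by move=> Uy yH; rewrite gtE (FE' y Uy yH); have [_ ->] := LE' y Uy yH.
have CK : Ck 1 U (fun y => L y *: F y) by exact: Ck_scale.
have curvt : chart_curv gt c p = jet_curv (F x)
    (fun i => 'D_(coord_vec i) L x *: F x + 'D_(coord_vec i) F x).
  rewrite (chart_curvE cp oU Ux CK KE) -/x Lx scale1r; congr jet_curv.
  by apply/funext => i; rewrite (derive_scale _ dL dF) Lx scale1r addrC.
have curv : chart_curv g c p = jet_curv (F x) (fun i => 'D_(coord_vec i) F x).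
  exact: chart_curvE cp oU Ux CF FE'.
have Fp : posdef (F x) by rewrite FE'//; exact: metric_posdef.
have Fs : (F x)^T = F x by rewrite FE'//; exact: (Defs.metric_sym g ac cx).
have nearU (v : E) : \forall t \near (0 : R)^'+, U (t *: v + x).
  have nU : nbhs x U by exact: open_nbhs_nbhs.
  exact: line_cvg_right nU.
(* The factor is constantly 1 along the boundary face. *)
have DL0 i : i != ord0 -> 'D_(coord_vec i) L x = 0.
  move=> i0; apply: derive_eq0 dL _; rewrite Lx.
  apply: filterS (nearU (coord_vec i)) => t Ut.
  have z0 : (t *: coord_vec i + x) ord0 ord0 = 0.
    by rewrite !mxE x0 eqxx /= eq_sym (negPf i0) mulr0 addr0.
  have zH : half_space (t *: coord_vec i + x) by rewrite /half_space /= z0.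
  have [cz ->] := LE' _ Ut zH; have [ciz cK] := chart_imageP cz.
  by rewrite f0 ?expR0//; apply/(boundaryP g ac ciz); rewrite cK.
(* Compare L with 1 + x_0 * b: on the half-space exp f >= 1 + f >= 1 + x_0 * b, with equality at
   [x], and the normal derivative of x_0 * b at x_0 = 0 is b. *)
have DL : b x <= 'D_(coord_vec ord0) L x.
  pose B (y : E) : R^o := (y ord0 ord0 : R^o) *: (b y : R^o).
  have db : differentiable (b : E -> R^o) x by have [d _] := bC; exact: d.
  have dc := differentiable_coordinate x ord0.
  have dB : differentiable B x.
    by have [] := is_diff_scale (differentiableP dc) (differentiableP db).
  have DB : 'D_(coord_vec ord0) B x = b x.
    rewrite (derive_scale _ dc db) derive_coordinate x0 scale0r add0r mxE !eqxx.
    exact: scale1r.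
  have d1B : differentiable ((cst 1 : E -> R^o) + B) x.
    by apply: differentiableD => //; exact: differentiable_cst.
  have <- : 'D_(coord_vec ord0) ((cst 1 : E -> R^o) + B) x = b x.
    rewrite deriveD; [|exact: derivable_cst|exact: diff_derivable].
    by rewrite derive_cst add0r.
  apply: derive_le => //.
    by rewrite Lx !fctE /B x0 scale0r addr0.
  have tpos : \forall t \near (0 : R)^'+, 0 < t by exact: nbhs_right_gt.
  apply: filterS2 tpos (nearU (coord_vec ord0)) => t t0 Ut.
  have zH : half_space (t *: coord_vec ord0 + x).
    by rewrite /half_space /= !mxE x0 addr0 eqxx mulr1; exact: ltW.
  have [cz ->] := LE' _ Ut zH; have [ciz cK] := chart_imageP cz.
  apply: le_trans (expR_ge1Dx _); rewrite lerD2l.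
  by have := bf _ ciz; rewrite cK.
have tu : tangential (F x) \in unitmx by exact/posdef_unit/posdef_tangential.
rewrite curvt curv (jet_curv_conformal _ DL0 tu) -FE'//.
rewrite lerD2l lerN2 ler_wpM2l// ler_wpM2l//.
by rewrite ltW// posdef_inv_diag.
Qed.

End Main.

(* The dimension of M is n = m+1. *)
Theorem corollary5p2 (R : realType) (m : nat) (hn : (3 <= m.+1)%N)
    (M : manifold R m) (hM : compact [set: M]) (g : riemannian_metric M) :
  exists gt : riemannian_metric M,
    conformal g gt /\
    forall (p : M) (c : chart R m M),
      boundary p -> atlas c -> chart_dom c p -> mean_curvature gt c p < 0.
Proof.
have m1 : (1 < m)%N by [].
have m0 : (0 < m)%N by exact: ltnW.
have /choice[cb cbP] : forall q : M, exists cb : chart R m M * ('rV[R]_m.+1 -> R),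
  [/\ atlas cb.1, forall y, 0 <= cb.2 y, forall k, Ck k setT (cb.2 : _ -> R^o),
    smooth_fun (chart_extend cb.1 (fun y => y ord0 ord0 * cb.2 y)) &
    \forall p \near q, chart_dom cb.1 p /\ chart_curv g cb.1 p <
      m%:R * (invmx (components g cb.1 (chart_map cb.1 p)) ord0 ord0
              * cb.2 (chart_map cb.1 p))].
  by move=> q; have [c [b]] := local_weight g q m0; exists (c, b).
have nearq q : [set: M] q -> nbhs q [set p | chart_dom (cb q).1 p /\ chart_curv g (cb q).1 p <
      m%:R * (invmx (components g (cb q).1 (chart_map (cb q).1 p)) ord0 ord0
              * (cb q).2 (chart_map (cb q).1 p))].
  by have [] := cbP q.
have [s sP] := compact_finite_cover hM nearq.
pose w q := chart_extend (cb q).1 (fun y => y ord0 ord0 * (cb q).2 y).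
have w0 q p : 0 <= w q p.
  rewrite /w /chart_extend; case: asboolP => // cp; have [_ b0 _ _ _] := cbP q.
  by rewrite mulr_ge0//; exact: (chart_image_half (chart_image_map cp)).
have w_bd q p : boundary p -> w q p = 0.
  move=> bp; rewrite /w /chart_extend; case: asboolP => // cp; have [ac _ _ _ _] := cbP q.
  by rewrite ((boundaryP g ac cp).1 bp) mul0r.
pose f p := \sum_(q <- s) w q p.
have fs : smooth_fun f by apply: smooth_fun_sum => q; have [] := cbP q.
have f_bd p : boundary p -> f p = 0.
  by move=> bp; rewrite /f big1 // => q _; exact: w_bd.
have wf q p : q \in s -> w q p <= f p.
  by move=> qs; rewrite /f (big_rem q qs) /= lerDl sumr_ge0.
have [gt [gc gtE]] := conformal_metric_exists g m1 fs.
exists gt; split=> // p c bp ac cp.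
have px := chart_image_map cp.
rewrite /mean_curvature coord_mean_curvature_lt0 //; last first.
- exact: metric_posdef.
- exact: (Defs.metric_sym gt ac px).
rewrite -/(chart_curv gt c p).
(* The strict inequality is available only in the chart attached to some [q] of the finite family;
   the positive factor [j] carries the sign over to the arbitrary chart [c]. *)
have [q qs [dp lt_q]] := sP p I; have [ad b0 bC _ _] := cbP q.
have [j j0 jE] := chart_curv_change gt ac ad cp dp ((boundaryP g ac cp).1 bp).
rewrite -(pmulr_rlt0 _ j0) jE.
apply: le_lt_trans (chart_curv_conformal fs ad dp bp (gtE _) f_bd (bC 1%N) _) _.
  move=> r dr; apply: le_trans (wf q r qs).
  by rewrite /w chart_extendE.
by rewrite subr_lt0.
Qed.
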